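(* Let $\mathcal{E}$ be an irreducible Dirichlet form on $L^2(m)$, let $p\in(1,\infty)$, and let $f\in L^p(m)$ be $L_p$-harmonic. Then $f$ is constant; more precisely, $$f=\begin{cases}\frac{1}{m(X)}\int_X f\,dm & \text{if } m(X)<\infty \text{ and } \mathcal{E} \text{ is conservative},\\ 0 & \text{otherwise.}\end{cases}$$ In particular, if there is a non-zero $L_p$-harmonic function for some $p\in(1,\infty)$, then $m(X)<\infty$.
   Context: $(X,\mathcal{B},m)$ is a $\sigma$-finite measure space and $\mathcal{E}$ is a (symmetric) Dirichlet form on $L^2(m)$, i.e. a closed, densely defined, nonnegative symmetric quadratic form with the Markov property ($\mathcal{E}(C\circ f)\le \mathcal{E}(f)$ for every normal contraction $C$). Let $L\ge 0$ be the associated self-adjoint operator and $T_t=e^{-tL}$ the associated Markovian semigroup. For $p\in[1,\infty)$ the semigroup extends consistently to a $C_0$-semigroup of contractions $(T_t)$ on $L^p(m)$ (the extensions agree on $L^p\cap L^q$); its generator is denoted $L_p$ (with sign convention $T_t=e^{-tL_p}$). A function $f\in L^p(m)$ is called $L_p$-harmonic if $f\in D(L_p)$ and $L_pf=0$. A measurable set $A$ is $\mathcal{E}$-invariant if $T_t(1_A f)=1_A T_t f$ for all $f\in L^2(m)$, $t\ge0$; $\mathcal{E}$ is irreducible if every $\mathcal{E}$-invariant set $A$ satisfies $m(A)=0$ or $m(X\setminus A)=0$. $\mathcal{E}$ is conservative if $T_t1=1$ for all $t\ge0$ (with $T_t$ extended to $L^\infty(m)$). *)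

(* Defs.v *)
From HB Require Import structures.
From mathcomp Require Import all_boot all_order all_algebra.
From mathcomp Require Import all_classical all_reals all_analysis.
Set Implicit Arguments. Unset Strict Implicit. Unset Printing Implicit Defensive.
Import Order.TTheory GRing.Theory Num.Theory.
Import numFieldNormedType.Exports.
Local Open Scope classical_set_scope.
Local Open Scope ring_scope.

Section DirichletDefs.
Context {d : measure_display} {X : measurableType d} {R : realType}.
Variable m : {measure set X -> \bar R}.

Definition inLp (p : R) (f : X -> R) : Prop :=
  measurable_fun setT f /\ ('N[m]_(p%:E)[EFin \o f] < +oo)%E.

Definition Lpdist (p : R) (f g : X -> R) : \bar R :=
  'N[m]_(p%:E)[EFin \o (f \- g)].

Definition aeeq (f g : X -> R) : Prop := {ae m, forall x, f x = g x}.

Definition pairing (f g : X -> R) : R := fine (\int[m]_x (f x * g x)%:E).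

(* A symmetric form on L^2(m) is given by its domain D (a set of
   representatives, closed under a.e. modification) and a bilinear map E. *)
Definition E1 (E : (X -> R) -> (X -> R) -> R) (f : X -> R) : R :=
  E f f + (fine (Lpdist 2 f (cst 0))) ^+ 2.

Definition normal_contraction (C : R -> R) : Prop :=
  C 0 = 0 /\ forall s t, `|C s - C t| <= `|s - t|.

Definition dirichlet_form (D : set (X -> R)) (E : (X -> R) -> (X -> R) -> R)
  : Prop :=
  (forall f, D f -> inLp 2 f) /\
  (forall f g, D f -> measurable_fun setT g -> aeeq f g ->
     D g /\ forall h, D h -> E f h = E g h) /\
  (forall (a : R) f g, D f -> D g -> D (fun x => a * f x + g x)) /\
  (forall (a : R) f g h, D f -> D g -> D h ->
     E (fun x => a * f x + g x) h = a * E f h + E g h) /\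
  (forall f g, D f -> D g -> E f g = E g f) /\
  (forall f, D f -> 0 <= E f f) /\
  (forall f, inLp 2 f -> forall eps : R, 0 < eps ->
     exists g, D g /\ (Lpdist 2 f g < eps%:E)%E) /\
  (forall u : nat -> X -> R, (forall n, D (u n)) ->
     (forall eps : R, 0 < eps -> exists N, forall n k, (N <= n)%N -> (N <= k)%N ->
        E1 E (u n \- u k) < eps) ->
     exists v, D v /\ (fun n => E1 E (u n \- v)) @ \oo --> 0) /\
  (forall C f, normal_contraction C -> D f ->
     D (C \o f) /\ E (C \o f) (C \o f) <= E f f).

(* L is the (nonnegative self-adjoint) operator associated with (D, E):
   f \in D(L) and L f = h  iff  f \in D, h \in L^2 and E(f,g) = <h,g> for all g \in D *)
Definition assoc_op (D : set (X -> R)) (E : (X -> R) -> (X -> R) -> R)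
  (f h : X -> R) : Prop :=
  D f /\ inLp 2 h /\ forall g, D g -> E f g = pairing h g.

(* generator relation on L^p with the sign convention T_t = e^{-t L_p}:
   f \in D(L_p) and L_p f = h  iff  f, h \in L^p and (f - T_t f)/t -> h in L^p *)
Definition gen_rel (p : R) (T : R -> (X -> R) -> (X -> R)) (f h : X -> R) : Prop :=
  inLp p f /\ inLp p h /\
  (fun t => Lpdist p (fun x => (f x - T t f x) / t) h) @ 0^'+ --> 0%E.

Definition Lp_harmonic (p : R) (T : R -> (X -> R) -> (X -> R)) (f : X -> R) : Prop :=
  gen_rel p T f (cst 0).

(* T (one family of maps acting on measurable functions) is the Markovian
   semigroup e^{-tL} associated with (D,E) on L^2 together with its
   consistent contractive extensions to every L^p, 1 <= p < oo. *)
Definition assoc_semigroup (D : set (X -> R)) (E : (X -> R) -> (X -> R) -> R)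
  (T : R -> (X -> R) -> (X -> R)) : Prop :=
  (forall (p t : R), 1 <= p -> 0 <= t ->
     (forall f, inLp p f -> inLp p (T t f) /\
        ('N[m]_(p%:E)[EFin \o T t f] <= 'N[m]_(p%:E)[EFin \o f])%E) /\
     (forall f g, inLp p f -> inLp p g -> aeeq f g -> aeeq (T t f) (T t g)) /\
     (forall (a : R) f g, inLp p f -> inLp p g ->
        aeeq (T t (fun x => a * f x + g x)) (fun x => a * T t f x + T t g x))) /\
  (forall f, inLp 2 f -> aeeq (T 0 f) f) /\
  (forall (s t : R) f, 0 <= s -> 0 <= t -> inLp 2 f ->
     aeeq (T (s + t) f) (T s (T t f))) /\
  (forall f, inLp 2 f -> (fun t => Lpdist 2 (T t f) f) @ 0^'+ --> 0%E) /\
  (forall f h, inLp 2 f -> inLp 2 h -> (gen_rel 2 T f h <-> assoc_op D E f h)).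

Definition invariant_set (T : R -> (X -> R) -> (X -> R)) (A : set X) : Prop :=
  forall (t : R) f, 0 <= t -> inLp 2 f ->
    aeeq (T t (fun x => \1_A x * f x)) (fun x => \1_A x * T t f x).

Definition irreducible (T : R -> (X -> R) -> (X -> R)) : Prop :=
  forall A, measurable A -> invariant_set T A -> m A = 0%E \/ m (~` A) = 0%E.

(* extension of T_t to L^oo by duality with L^1 (T_t symmetric):
   T_t g = h  iff  <h, f> = <g, T_t f> for all f in L^1 *)
Definition Tinf_rel (T : R -> (X -> R) -> (X -> R)) (t : R) (g h : X -> R) : Prop :=
  forall f, inLp 1 f -> pairing h f = pairing g (T t f).

Definition conservative (T : R -> (X -> R) -> (X -> R)) : Prop :=
  forall t : R, 0 <= t -> Tinf_rel T t (cst 1) (cst 1).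

End DirichletDefs.

(* Main.v *)
(* T_t is sub-Markovian: for u in the domain of the generator the excess
   w = (T_s u - c)^+ satisfies E(T_s u, w) >= 0 by the Markov property of E, so
   |w|^2 is nonincreasing in s.  Resolvents of data bounded by c are bounded by c
   and approximate them, which gives T_t f <= c for every f <= c in L^2, and then
   in L^p by truncation; c = 0 gives positivity.
   A harmonic f satisfies T_t f = f, because |T_t f - f|_p <= n |T_(t/n) f - f|_p
   = n o(t/n).  Then T_t (f - c)^+ >= (f - c)^+ for c >= 0, with equality since
   T_t is a contraction of L^p.  If h >= 0 is fixed by T_t, the set {h > 0} is
   invariant: functions supported in it are limits of functions dominated by
   multiples of h, and the complement is handled by symmetry.  Hence every level
   set {f > c} is null or conull, and f is constant. *)
Require Import Defs.
From HB Require Import structures.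
From mathcomp Require Import all_boot all_order all_algebra.
From mathcomp Require Import all_classical all_reals all_analysis.
From mathcomp Require Import measurable_realfun ring lra.
Import Order.TTheory GRing.Theory Num.Theory.
Import numFieldNormedType.Exports.
Set Implicit Arguments. Unset Strict Implicit. Unset Printing Implicit Defensive.
Local Open Scope classical_set_scope.
Local Open Scope ring_scope.

(** * L^p norms and the L^2 pairing *)

Section Lp.
Context {d : measure_display} {X : measurableType d} {R : realType}.
Variable m : {measure set X -> \bar R}.
Implicit Types (f g h : X -> R) (p q a c eps dlt : R).

(** The form and the semigroup are linked only through the generator on L^2. Order properties and
    symmetry of [T] are therefore obtained on the generator domain, where there is a rate of change
    to estimate, and density carries them over. No curve is differentiated: a real function of time
    is compared at 0 and t through small steps whose error is [eps * r]. This needs one step size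
    valid for all starting times, and commuting [T s] with the expansion at time 0 provides it.
    Levels c are kept nonnegative throughout: only then does s -> min(s, c) fix 0, so that it is a
    normal contraction and cutting stays inside L^p even when the total mass is infinite. A function
    of variable sign is thus handled through both f and -f. As for the two cases of the formula, a
    nonzero constant in L^p forces finite mass, and dividing T_t f = f by that constant gives T_t 1
    = 1, hence conservativeness. Outside the finite conservative case only the constant 0
    survives. *)

Definition nrm p f : R := fine ('N[m]_(p%:E)[EFin \o f])%E.

Lemma aeeq_refl f : aeeq m f f.
Proof. exact: aeW. Qed.

Lemma aeeq_sym f g : aeeq m f g -> aeeq m g f.
Proof. by apply: filterS => x ->. Qed.

Lemma aeeq_trans f g h : aeeq m f g -> aeeq m g h -> aeeq m f h.
Proof. by apply: filterS2 => x -> ->. Qed.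

(** [fine] sends an infinite norm to 0, so [nrm] is the genuine norm only on members of L^p. *)
Lemma nrmE p f : inLp m p f -> ('N[m]_(p%:E)[EFin \o f] = (nrm p f)%:E)%E.
Proof.
by case=> _ ff; rewrite /nrm fineK// ge0_fin_numE// Lnorm_ge0.
Qed.

Lemma nrm_ge0 p f : 0 <= nrm p f.
Proof. by rewrite /nrm fine_ge0// Lnorm_ge0. Qed.

Lemma inLp_meas p f : inLp m p f -> measurable_fun setT f.
Proof. by case. Qed.

Lemma measurable_powR_abs p f :
  measurable_fun setT f -> measurable_fun setT (fun x => `|f x| `^ p).
Proof.
move=> mf.
by apply: (@measurableT_comp _ _ _ _ _ _ (@powR R ^~ p)) => //; exact: measurableT_comp.
Qed.

Lemma Lnorm_le p f g : 0 < p -> measurable_fun setT f -> measurable_fun setT g ->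
  {ae m, forall x, `|f x| <= `|g x|} ->
  ('N[m]_(p%:E)[EFin \o f] <= 'N[m]_(p%:E)[EFin \o g])%E.
Proof.
move=> p0 mf mg fg; rewrite unlock.
have h0 k : (0 <= \int[m]_x (`|(EFin \o k) x| `^ p))%E.
  by apply: integral_ge0 => x _; exact: poweR_ge0.
apply: gt0_ler_poweR; [by rewrite invr_ge0 ltW|by rewrite in_itv/= leey h0..|].
apply: ae_ge0_le_integral => //.
- by move=> x _; exact: poweR_ge0.
- by apply/measurable_EFinP; exact: measurable_powR_abs.
- by move=> x _; exact: poweR_ge0.
- by apply/measurable_EFinP; exact: measurable_powR_abs.
apply: filterS fg => x fgx _ /=.
by rewrite lee_fin ge0_ler_powR// ?nnegrE// ltW.
Qed.

Lemma inLp_le p f g : 1 <= p -> measurable_fun setT f -> inLp m p g ->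
  {ae m, forall x, `|f x| <= `|g x|} -> inLp m p f /\ nrm p f <= nrm p g.
Proof.
move=> p1 mf Lg fg.
have le := Lnorm_le (lt_le_trans ltr01 p1) mf (inLp_meas Lg) fg.
have Lf : inLp m p f by split=> //; apply: le_lt_trans le _; case: Lg.
by split=> //; rewrite -lee_fin -!nrmE.
Qed.

Lemma inLp_dom p f g : 1 <= p -> measurable_fun setT f -> inLp m p g ->
  (forall x, `|f x| <= `|g x|) -> inLp m p f.
Proof. by move=> p1 mf Lg fg; case: (inLp_le p1 mf Lg) => //; exact: aeW. Qed.

Lemma nrm_ae p f g : 1 <= p -> measurable_fun setT f -> inLp m p g ->
  aeeq m f g -> inLp m p f /\ nrm p f = nrm p g.
Proof.
move=> p1 mf Lg fg.
have [Lf le1] : inLp m p f /\ nrm p f <= nrm p g.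
  by apply: inLp_le => //; apply: filterS fg => x ->.
split=> //; apply/eqP; rewrite eq_le le1/=.
have [//|_ ->//] := inLp_le p1 (inLp_meas Lg) Lf.
by apply: filterS fg => x ->.
Qed.

Lemma inLpD p f g : 1 <= p -> inLp m p f -> inLp m p g ->
  inLp m p (fun x => f x + g x).
Proof.
move=> p1 [mf Lf] [mg Lg]; split; first exact: measurable_funD.
apply: (le_lt_trans (minkowski_EFin m mf mg p1)).
by rewrite lte_add_pinfty.
Qed.

Lemma nrmD p f g : 1 <= p -> inLp m p f -> inLp m p g ->
  nrm p (fun x => f x + g x) <= nrm p f + nrm p g.
Proof.
move=> p1 Lf Lg; rewrite -lee_fin EFinD -!nrmE//; last exact: inLpD.
by apply: minkowski_EFin => //; [case: Lf|case: Lg].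
Qed.

Lemma LnormZ_fun p f a : 1 <= p -> inLp m p f ->
  ('N[m]_(p%:E)[EFin \o (fun x => (a * f x)%R)] = `|a|%:E * 'N[m]_(p%:E)[EFin \o f])%E.
Proof.
move=> p1 Lf.
have p1' : (1 <= p%:E)%E by rewrite lee_fin.
have Lf' : f \in Lfun m p%:E.
  by case: Lf => mf ff; rewrite inE; apply/andP; split; rewrite inE.
exact: (LnormZ (p1 := p1') (Lfun_Sub p1' Lf') a).
Qed.

Lemma inLpZ p f a : 1 <= p -> inLp m p f -> inLp m p (fun x => a * f x).
Proof.
move=> p1 Lf; split; first by apply: measurable_funM => //; case: Lf.
by rewrite LnormZ_fun// (nrmE Lf) -EFinM ltry.
Qed.

Lemma nrmZ p f a : 1 <= p -> inLp m p f -> nrm p (fun x => a * f x) = `|a| * nrm p f.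
Proof. by move=> p1 Lf; rewrite {1}/nrm LnormZ_fun// (nrmE Lf). Qed.

Lemma inLpN p f : 1 <= p -> inLp m p f -> inLp m p (fun x => - f x).
Proof.
move=> p1 Lf; apply: (inLp_dom p1 _ Lf); last by move=> x; rewrite normrN.
by apply: measurableT_comp => //; case: Lf.
Qed.

Lemma inLpB p f g : 1 <= p -> inLp m p f -> inLp m p g ->
  inLp m p (fun x => f x - g x).
Proof. by move=> p1 Lf Lg; apply: inLpD => //; exact: inLpN. Qed.

Lemma inLp0 p : 1 <= p -> inLp m p (fun=> 0).
Proof.
move=> p1; split => //.
rewrite (_ : EFin \o _ = cst 0%E)// Lnorm0 ?ltry//.
by rewrite eqe gt_eqF// (lt_le_trans ltr01).
Qed.

Lemma nrmN p f : 1 <= p -> inLp m p f -> nrm p (fun x => - f x) = nrm p f.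
Proof.
move=> p1 Lf; have := nrmZ (-1) p1 Lf.
rewrite normrN1 mul1r => <-; congr nrm.
by apply/funext => x; rewrite mulN1r.
Qed.

Lemma nrmBC p f g : 1 <= p -> inLp m p f -> inLp m p g ->
  nrm p (fun x => f x - g x) = nrm p (fun x => g x - f x).
Proof.
move=> p1 Lf Lg; rewrite -nrmN//; last exact: inLpB.
by congr nrm; apply/funext => x; rewrite opprB.
Qed.

Lemma nrmB p f g : 1 <= p -> inLp m p f -> inLp m p g ->
  nrm p (fun x => f x - g x) <= nrm p f + nrm p g.
Proof.
move=> p1 Lf Lg; rewrite -(nrmN p1 Lg).
by apply: nrmD => //; exact: inLpN.
Qed.

Lemma nrm_dist p f g h : 1 <= p -> inLp m p f -> inLp m p g -> inLp m p h ->
  nrm p (fun x => f x - h x) <=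
  nrm p (fun x => f x - g x) + nrm p (fun x => g x - h x).
Proof.
move=> p1 Lf Lg Lh.
rewrite (_ : (fun x => f x - h x) = fun x => (f x - g x) + (g x - h x)).
  by apply: nrmD => //; exact: inLpB.
by apply/funext => x; ring.
Qed.

Lemma nrm_eq0 p f : 1 <= p -> inLp m p f -> nrm p f = 0 -> aeeq m f (fun=> 0).
Proof.
move=> p1 Lf f0.
have /measurable_EFinP mf := inLp_meas Lf.
have := Lnorm_eq0_eq0 (mu := m) (f := EFin \o f) (p := p%:E) mf.
rewrite lte_fin (nrmE Lf) f0 => /(_ (lt_le_trans ltr01 p1) erefl).
by apply: filterS => x /(_ I) [].
Qed.

Lemma nrm_dist_eq0 p f g : 1 <= p -> inLp m p f -> inLp m p g ->
  nrm p (fun x => f x - g x) <= 0 -> aeeq m f g.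
Proof.
move=> p1 Lf Lg fg; have : nrm p (fun x => f x - g x) = 0.
  by apply/eqP; rewrite eq_le fg nrm_ge0.
move/(nrm_eq0 p1 (inLpB p1 Lf Lg)); apply: filterS => x /eqP.
by rewrite subr_eq0 => /eqP.
Qed.

Lemma nrm_dist_ae p f g : 1 <= p -> inLp m p f -> inLp m p g -> aeeq m f g ->
  nrm p (fun x => f x - g x) = 0.
Proof.
move=> p1 Lf Lg fg.
have [_ ->] : inLp m p (fun x => f x - g x) /\
    nrm p (fun x => f x - g x) = nrm p (fun=> 0).
  apply: nrm_ae => //; [|exact: inLp0|].
    by apply: inLp_meas; exact: (inLpB p1 Lf Lg).
  by apply: filterS fg => x ->; rewrite subrr.
have := nrmZ 0 p1 (inLp0 p1); by rewrite normr0 !mul0r.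
Qed.

Lemma Lpdist_nrm p f g : 1 <= p -> inLp m p f -> inLp m p g ->
  Lpdist m p f g = (nrm p (fun x => f x - g x))%:E.
Proof. by move=> p1 Lf Lg; rewrite -nrmE//; exact: inLpB. Qed.

Lemma nrm_le_dist p f g : 1 <= p -> inLp m p f -> inLp m p g ->
  nrm p f <= nrm p g + nrm p (fun x => f x - g x).
Proof.
move=> p1 Lf Lg.
rewrite {1}(_ : f = fun x => g x + (f x - g x)).
  by apply: nrmD => //; exact: inLpB.
by apply/funext => x; ring.
Qed.

Let p12 : (1 : R) <= 2. Proof. by rewrite ler1n. Qed.

Lemma inLp_Lfun p f : 1 <= p -> inLp m p f -> f \in Lfun m p%:E.
Proof. by move=> p1 [mf ff]; rewrite inE; apply/andP; split; rewrite inE. Qed.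

Lemma pairing_integrable f g : inLp m 2 f -> inLp m 2 g ->
  m.-integrable setT (fun x => (f x * g x)%:E).
Proof.
move=> Lf Lg.
by have := Lfun2_mul_Lfun1 (inLp_Lfun p12 Lf) (inLp_Lfun p12 Lg) => /Lfun1_integrable.
Qed.

Lemma pairingC f g : pairing m f g = pairing m g f.
Proof. by rewrite /pairing; under eq_integral do rewrite mulrC. Qed.

Lemma pairingE f g : inLp m 2 f -> inLp m 2 g ->
  (\int[m]_x (f x * g x)%:E = (pairing m f g)%:E)%E.
Proof.
move=> Lf Lg; rewrite /pairing fineK//.
exact: integrable_fin_num (pairing_integrable Lf Lg).
Qed.

Lemma pairingDl f g h : inLp m 2 f -> inLp m 2 g -> inLp m 2 h ->
  pairing m (fun x => f x + g x) h = pairing m f h + pairing m g h.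
Proof.
move=> Lf Lg Lh; apply: EFin_inj; rewrite EFinD -!pairingE//; last exact: inLpD.
rewrite -integralD//; [|exact: pairing_integrable..].
by apply: eq_integral => x _; rewrite mulrDl EFinD.
Qed.

Lemma pairingZl f g a : inLp m 2 f -> inLp m 2 g ->
  pairing m (fun x => a * f x) g = a * pairing m f g.
Proof.
move=> Lf Lg; apply: EFin_inj; rewrite EFinM -!pairingE//; last exact: inLpZ.
rewrite -integralZl//; last exact: pairing_integrable.
by apply: eq_integral => x _; rewrite -mulrA EFinM.
Qed.

Lemma pairingNl f g : inLp m 2 f -> inLp m 2 g ->
  pairing m (fun x => - f x) g = - pairing m f g.
Proof.
move=> Lf Lg; rewrite -mulN1r -pairingZl//; congr pairing.
by apply/funext => x; rewrite mulN1r.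
Qed.

Lemma pairingBl f g h : inLp m 2 f -> inLp m 2 g -> inLp m 2 h ->
  pairing m (fun x => f x - g x) h = pairing m f h - pairing m g h.
Proof. by move=> Lf Lg Lh; rewrite pairingDl ?pairingNl//; exact: inLpN. Qed.

Lemma pairingDr f g h : inLp m 2 f -> inLp m 2 g -> inLp m 2 h ->
  pairing m h (fun x => f x + g x) = pairing m h f + pairing m h g.
Proof. by move=> *; rewrite pairingC pairingDl// !(pairingC h). Qed.

Lemma pairingZr f g a : inLp m 2 f -> inLp m 2 g ->
  pairing m g (fun x => a * f x) = a * pairing m g f.
Proof. by move=> *; rewrite pairingC pairingZl// (pairingC g). Qed.

Lemma pairingBr f g h : inLp m 2 f -> inLp m 2 g -> inLp m 2 h ->
  pairing m h (fun x => f x - g x) = pairing m h f - pairing m h g.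
Proof. by move=> *; rewrite pairingC pairingBl// !(pairingC h). Qed.

Lemma pairing_le f g f' g' : inLp m 2 f -> inLp m 2 g -> inLp m 2 f' -> inLp m 2 g' ->
  (forall x, f x * g x <= f' x * g' x) -> pairing m f g <= pairing m f' g'.
Proof.
move=> Lf Lg Lf' Lg' le; rewrite -lee_fin -!pairingE//.
apply: le_integral => //; [exact: pairing_integrable..|].
by move=> x _; rewrite lee_fin.
Qed.

Lemma pairing_sqr f : inLp m 2 f -> pairing m f f = nrm 2 f ^+ 2.
Proof.
move=> Lf; apply: EFin_inj; rewrite -pairingE// EFin_expe -nrmE//.
have := poweR_Lnorm m (EFin \o f) (r := 2).
rewrite (nrmE Lf) poweR_EFin powR_mulrn ?nrm_ge0// -EFin_expe => -> //.
by apply: eq_integral => x _; rewrite /= powR_mulrn// real_normK ?num_real// expr2.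
Qed.

Lemma pairing_CS f g : inLp m 2 f -> inLp m 2 g ->
  `|pairing m f g| <= nrm 2 f * nrm 2 g.
Proof.
move=> Lf Lg; rewrite -lee_fin.
have h := hoelder m (inLp_meas Lf) (inLp_meas Lg) (ltr0Sn _ 1) (ltr0Sn _ 1).
rewrite EFinM -!nrmE//; apply: le_trans (h _); last lra.
rewrite Lnorm1 -abse_EFin -pairingE//.
apply: le_abse_integral => //.
by have /integrableP[] := pairing_integrable Lf Lg.
Qed.

Lemma pairing_le_nrm f g : inLp m 2 f -> inLp m 2 g ->
  pairing m f g <= nrm 2 f * nrm 2 g.
Proof. by move=> Lf Lg; apply: le_trans (ler_norm _) (pairing_CS Lf Lg). Qed.

Lemma pairing_ael f f' g : inLp m 2 f -> inLp m 2 f' -> inLp m 2 g ->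
  aeeq m f f' -> pairing m f g = pairing m f' g.
Proof.
move=> Lf Lf' Lg ff; apply/eqP; rewrite -subr_eq0 -pairingBl// -normr_le0.
rewrite (le_trans (pairing_CS (inLpB p12 Lf Lf') Lg))//.
by rewrite nrm_dist_ae ?mul0r.
Qed.

Lemma pairing_ae f g f' g' : inLp m 2 f -> inLp m 2 g -> inLp m 2 f' -> inLp m 2 g' ->
  aeeq m f f' -> aeeq m g g' -> pairing m f g = pairing m f' g'.
Proof.
move=> Lf Lg Lf' Lg' ff gg.
by rewrite (pairing_ael Lf Lf' Lg ff) pairingC (pairing_ael Lg Lg' Lf' gg) pairingC.
Qed.

End Lp.

(** * Density of truncations in L^p *)

Section density.
Context {d : measure_display} {X : measurableType d} {R : realType}.
Variable m : {measure set X -> \bar R}.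
Implicit Types (f g h : X -> R) (p q a c eps dlt : R).

Lemma nrm_powR p f : 1 <= p -> inLp m p f ->
  (\int[m]_x (`|f x| `^ p)%:E = (nrm m p f `^ p)%:E)%E.
Proof.
move=> p1 Lf; rewrite -poweR_EFin -nrmE// poweR_Lnorm//.
by rewrite gt_eqF// (lt_le_trans ltr01).
Qed.

(** Dominated convergence with [|f| ^ p] as dominating function. Eventual equality at each point is
    asked for instead of convergence because the truncations used below stabilise pointwise. *)
Lemma nrm_dominated p (u : nat -> X -> R) f : 1 <= p -> inLp m p f ->
  (forall n, measurable_fun setT (u n)) ->
  (forall n x, `|f x - u n x| <= `|f x|) ->
  (forall x, \forall n \near \oo, u n x = f x) ->
  forall eps, 0 < eps -> exists n, inLp m p (u n) /\
    nrm m p (fun x => f x - u n x) <= eps.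
Proof.
move=> p1 Lf mu dom cvgu eps eps0.
have p0 : 0 < p by exact: lt_le_trans p1.
have mfu n : measurable_fun setT (fun x => f x - u n x).
  by apply: measurable_funB => //; exact: inLp_meas Lf.
have Lfu n : inLp m p (fun x => f x - u n x) by exact: (inLp_dom p1 _ Lf).
have Lu n : inLp m p (u n).
  rewrite (_ : u n = fun x => f x - (f x - u n x)); first exact: inLpB.
  by apply/funext => x; ring.
have : (\int[m]_x (`|f x - u n x| `^ p)%:E @[n --> \oo] --> \int[m]_x (cst 0 x))%E.
  apply: (@dominated_cvg _ _ _ m setT measurableT _ _
    (fun x => (`|f x| `^ p)%:E)) => //.
  - by move=> n; apply/measurable_EFinP; exact: measurable_powR_abs.
  - move=> x _; apply: cvg_near_cst; apply: filterS (cvgu x) => n ->.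
    by rewrite subrr normr0 powR0// gt_eqF.
  - exact: Lfun_integrable (inLp_Lfun p1 Lf).
  - move=> n x _; rewrite /= lee_fin ger0_norm ?powR_ge0//.
    by rewrite ge0_ler_powR ?nnegrE ?(ltW p0).
rewrite integral0 => /fine_cvgP[_] /cvgr0Pnorm_lt /(_ (eps `^ p)).
rewrite powR_gt0// => /(_ isT)[N _ /(_ N (leqnn N))/=].
rewrite nrm_powR//= ger0_norm ?powR_ge0// => le.
exists N; split=> //; rewrite leNgt; apply/negP => lt.
move: le; rewrite ltNge ge0_ler_powR ?nnegrE ?nrm_ge0 ?(ltW p0) ?(ltW eps0)//.
exact: ltW.
Qed.

(** Keeping f only where |f| lies between 1/(n+1) and n+1 works whichever of p and q is larger. The
    last clause preserves every upper bound c >= 0 of f. *)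
Lemma trunc_dense p q f : 1 <= p -> 1 <= q -> inLp m p f ->
  forall eps, 0 < eps -> exists g, [/\ inLp m p g, inLp m q g,
    nrm m p (fun x => f x - g x) <= eps & forall x, g x = f x \/ g x = 0].
Proof.
move=> p1 q1 Lf eps eps0.
have p0 : 0 < p by exact: lt_le_trans p1.
have q0 : 0 < q by exact: lt_le_trans q1.
have mf := inLp_meas Lf.
pose B n : set X := [set x | `|f x| \in `[n.+1%:R^-1, n.+1%:R] ].
have mB n : measurable (B n).
  rewrite (_ : B n = (fun x => `|f x|) @^-1` [set` `[n.+1%:R^-1, n.+1%:R] ]) //.
  rewrite -[X in measurable X]setTI.
  have mnf : measurable_fun setT (fun x => `|f x|) by exact: measurableT_comp.
  exact: mnf.
pose u n x := f x * \1_(B n) x.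
have uB n x : u n x = f x /\ B n x \/ u n x = 0 /\ ~ B n x.
  rewrite /u indicE; have [|] := pselect (B n x) => Bx.
    by left; rewrite mem_set// mulr1.
  by right; rewrite memNset// mulr0.
have mu n : measurable_fun setT (u n) by exact: measurable_funM.
have [||n [Lu le]] := nrm_dominated p1 Lf mu _ _ eps0.
- by move=> n x; case: (uB n x) => -[-> _]; rewrite ?subrr ?subr0 ?normr0.
- move=> x; have [fx0|fx0] := eqVneq (f x) 0.
    by apply: nearW => n; rewrite /u fx0 mul0r.
  have nf : 0 < `|f x| by rewrite normr_gt0.
  near=> n; case: (uB n x) => -[]// _ []; rewrite /B /= in_itv/=.
  rewrite invf_ple ?posrE//; apply/andP; split.
    by rewrite (le_trans _ (_ : n%:R <= _)) ?ler_nat//; near: n; exact: nbhs_infty_ger.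
  by rewrite (le_trans _ (_ : n%:R <= _)) ?ler_nat//; near: n; exact: nbhs_infty_ger.
exists (u n); split => //; last by move=> x; case: (uB n x) => -[? _]; [left|right].
split=> //; rewrite unlock poweR_lty//.
(* Where f is kept, |f|^q is at most (n+1)^q and 1 is at most (n+1)^p |f|^p; [K] is the product of
   the two factors. *)
pose K : R := n.+1%:R `^ q * n.+1%:R `^ p.
have h x : `|u n x| `^ q <= K * `|f x| `^ p.
  have K0 : 0 <= K * `|f x| `^ p by rewrite !mulr_ge0 ?powR_ge0.
  case: (uB n x) => -[-> Bx]; last by rewrite normr0 powR0// gt_eqF.
  move: Bx; rewrite /B /= in_itv/= => /andP[l1 l2].
  rewrite /K -mulrA -powRM// -[leLHS]mulr1 ler_pM ?powR_ge0//.
    by rewrite ge0_ler_powR ?nnegrE ?(ltW q0).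
  apply: (@le_trans _ _ (1 `^ p)); first by rewrite powR1.
  rewrite ge0_ler_powR ?nnegrE ?(ltW p0) ?mulr_ge0//.
  by rewrite -ler_pdivrMl// mulr1.
apply: (@le_lt_trans _ _ (\int[m]_x (K%:E * (`|f x| `^ p)%:E))%E).
  apply: ge0_le_integral => //.
  - by move=> x _; exact: poweR_ge0.
  - by apply/measurable_EFinP; exact: measurable_powR_abs.
  - apply: emeasurable_funM => //.
    by apply/measurable_EFinP; exact: measurable_powR_abs.
  - by move=> x _ /=; rewrite -EFinM lee_fin.
rewrite integralZl//; last exact: Lfun_integrable (inLp_Lfun p1 Lf).
by rewrite nrm_powR// -EFinM ltry.
Unshelve. all: end_near. Qed.

Lemma aeeq_nrm_small p f g : 1 <= p -> inLp m p f -> inLp m p g ->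
  (forall eps, 0 < eps -> nrm m p (fun x => f x - g x) <= eps) -> aeeq m f g.
Proof.
move=> p1 Lf Lg h; apply: (nrm_dist_eq0 p1) => //.
by apply/ler_addgt0Pl => e e0; rewrite addr0; exact: h.
Qed.

End density.

(** * The semigroup on L^p *)

Section cvg_right.
Context {R : realType}.

Lemma cvg0_at_right (F : R -> \bar R) : (forall t : R, 0 < t -> (0 <= F t)%E) ->
  F @ 0^'+ --> 0%E <->
  forall eps : R, 0 < eps -> exists2 dlt : R, 0 < dlt &
    forall t : R, 0 < t -> t < dlt -> (F t <= eps%:E)%E.
Proof.
move=> F0; split=> [/fine_cvgP[Ffin] /cvgr0Pnorm_le Fle eps eps0|h].
  have [dlt /= dlt0 H] := filterI Ffin (Fle _ eps0).
  exists dlt => // t t0 tdlt.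
  have [|//|ft le] := H t; first by rewrite /ball_/= sub0r normrN gtr0_norm.
  by rewrite -(fineK ft) lee_fin (le_trans (ler_norm _)).
have near_le eps : 0 < eps -> \forall t \near 0^'+, (0 <= F t <= eps%:E)%E.
  move=> eps0; have [dlt dlt0 H] := h _ eps0.
  near=> t; have t0 : 0 < t by near: t; exact: nbhs_right_gt.
  rewrite F0// H//; near: t; exact: nbhs_right_lt.
apply/fine_cvgP; split.
  apply: filterS (near_le 1 ltr01) => t /andP[t0 t1].
  by rewrite ge0_fin_numE// (le_lt_trans t1)// ltry.
apply/cvgr0Pnorm_le => eps eps0; apply: filterS (near_le _ eps0) => t /andP[t0 t1] /=.
rewrite ger0_norm ?fine_ge0// -lee_fin fineK//.
by rewrite ge0_fin_numE// (le_lt_trans t1)// ltry.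
Unshelve. all: end_near. Qed.

End cvg_right.

Section semigroup.
Context {d : measure_display} {X : measurableType d} {R : realType}.
Variable m : {measure set X -> \bar R}.
Variables (D : set (X -> R)) (E : (X -> R) -> (X -> R) -> R).
Variable T : R -> (X -> R) -> (X -> R).
Hypothesis TS : assoc_semigroup m D E T.
Implicit Types (f g h u v : X -> R) (p q a c s t eps dlt : R).

Lemma T_inLp p t f : 1 <= p -> 0 <= t -> inLp m p f -> inLp m p (T t f).
Proof. by case: TS => + _ p1 t0 Lf => /(_ p t p1 t0)[/(_ f Lf)[]]. Qed.

Lemma T_contract p t f : 1 <= p -> 0 <= t -> inLp m p f ->
  nrm m p (T t f) <= nrm m p f.
Proof.
move=> p1 t0 Lf; rewrite -lee_fin -!nrmE//; last exact: T_inLp.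
by case: TS => + _ => /(_ p t p1 t0)[/(_ f Lf)[]].
Qed.

Lemma T_ae p t f g : 1 <= p -> 0 <= t -> inLp m p f -> inLp m p g ->
  aeeq m f g -> aeeq m (T t f) (T t g).
Proof. by case: TS => + _ p1 t0 Lf Lg => /(_ p t p1 t0)[_ [+ _]] => /(_ f g Lf Lg). Qed.

Lemma T_linear p t a f g : 1 <= p -> 0 <= t -> inLp m p f -> inLp m p g ->
  aeeq m (T t (fun x => a * f x + g x)) (fun x => a * T t f x + T t g x).
Proof. by case: TS => + _ p1 t0 Lf Lg => /(_ p t p1 t0)[_ [_ +]] => /(_ a f g Lf Lg). Qed.

Lemma T_zero p t : 1 <= p -> 0 <= t -> aeeq m (T t (fun=> 0)) (fun=> 0).
Proof.
move=> p1 t0; have := T_linear (-1) p1 t0 (inLp0 m p1) (inLp0 m p1).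
rewrite (_ : (fun=> -1 * 0 + 0) = fun=> 0); last by apply/funext => x; rewrite mulr0 addr0.
by apply: filterS => x ->; rewrite mulN1r addNr.
Qed.

Lemma T_scale p t a f : 1 <= p -> 0 <= t -> inLp m p f ->
  aeeq m (T t (fun x => a * f x)) (fun x => a * T t f x).
Proof.
move=> p1 t0 Lf; have := T_linear a p1 t0 Lf (inLp0 m p1).
rewrite (_ : (fun x => a * f x + 0) = fun x => a * f x); last first.
  by apply/funext => x; rewrite addr0.
by apply: filterS2 (T_zero p1 t0) => x -> ->; rewrite addr0.
Qed.

Lemma T_opp p t f : 1 <= p -> 0 <= t -> inLp m p f ->
  aeeq m (T t (fun x => - f x)) (fun x => - T t f x).
Proof.
move=> p1 t0 Lf; have := T_scale (-1) p1 t0 Lf.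
rewrite (_ : (fun x => -1 * f x) = fun x => - f x); last first.
  by apply/funext => x; rewrite mulN1r.
by apply: filterS => x ->; rewrite mulN1r.
Qed.

Lemma T_sub p t f g : 1 <= p -> 0 <= t -> inLp m p f -> inLp m p g ->
  aeeq m (T t (fun x => f x - g x)) (fun x => T t f x - T t g x).
Proof.
move=> p1 t0 Lf Lg; have := T_linear (-1) p1 t0 Lg Lf.
rewrite (_ : (fun x => -1 * g x + f x) = fun x => f x - g x); last first.
  by apply/funext => x; ring.
by apply: filterS => x ->; ring.
Qed.

Lemma T_dist p t f g : 1 <= p -> 0 <= t -> inLp m p f -> inLp m p g ->
  nrm m p (fun x => T t f x - T t g x) <= nrm m p (fun x => f x - g x).
Proof.
move=> p1 t0 Lf Lg; have Lfg := inLpB p1 Lf Lg.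
have [_ <-] := nrm_ae p1 (inLp_meas (T_inLp p1 t0 Lfg))
  (inLpB p1 (T_inLp p1 t0 Lf) (T_inLp p1 t0 Lg)) (T_sub p1 t0 Lf Lg).
exact: T_contract.
Qed.

Let p12 : (1 : R) <= 2. Proof. by rewrite ler1n. Qed.

(* The hypotheses give the semigroup law on L^2 only. *)
Lemma T_semigroup p s t f : 1 <= p -> 0 <= s -> 0 <= t -> inLp m p f ->
  aeeq m (T (s + t) f) (T s (T t f)).
Proof.
move=> p1 s0 t0 Lf; have st0 : 0 <= s + t by rewrite addr_ge0.
have TLp := T_inLp p1.
apply: (aeeq_nrm_small p1); [exact: TLp|exact: TLp _ _ s0 (TLp _ _ t0 Lf)|move=> eps eps0].
have e20 : 0 < eps / 2 by rewrite divr_gt0.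
have [g [Lg L2g fg _]] := trunc_dense p1 p12 Lf e20.
apply: le_trans (nrm_dist p1 (TLp _ _ st0 Lf) (TLp _ _ st0 Lg) (TLp _ _ s0 (TLp _ _ t0 Lf))) _.
rewrite [leRHS]splitr lerD//; first exact: le_trans (T_dist p1 st0 Lf Lg) fg.
have Lsg := TLp _ _ s0 (TLp _ _ t0 Lg).
apply: le_trans (nrm_dist p1 (TLp _ _ st0 Lg) Lsg (TLp _ _ s0 (TLp _ _ t0 Lf))) _.
rewrite (nrm_dist_ae p1 _ Lsg) ?add0r; [|exact: TLp|]; last first.
  by case: TS => _ [_ [+ _]]; apply.
apply: le_trans (T_dist p1 s0 (TLp _ _ t0 Lg) (TLp _ _ t0 Lf)) _.
by apply: le_trans (T_dist p1 t0 Lg Lf) _; rewrite nrmBC.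
Qed.

Lemma T0_id p f : 1 <= p -> inLp m p f -> aeeq m (T 0 f) f.
Proof.
move=> p1 Lf; have TL := T_inLp p1 (lexx 0).
apply: (aeeq_nrm_small p1) => [|//|eps eps0]; first exact: TL.
have e20 : 0 < eps / 2 by rewrite divr_gt0.
have [g [Lg L2g fg _]] := trunc_dense p1 p12 Lf e20.
apply: le_trans (nrm_dist p1 (TL _ Lf) (TL _ Lg) Lf) _.
rewrite [leRHS]splitr lerD//; first exact: le_trans (T_dist p1 (lexx 0) Lf Lg) fg.
apply: le_trans (nrm_dist p1 (TL _ Lg) Lg Lf) _.
rewrite nrm_dist_ae ?add0r//; [by rewrite nrmBC|exact: TL|].
by case: TS => _ [+ _]; apply.
Qed.

(** The difference quotient multiplied by t: a first-order expansion with error [eps * t], the form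
    that telescopes over small time steps. *)
Lemma gen_relP p f h : 1 <= p -> gen_rel m p T f h <->
  [/\ inLp m p f, inLp m p h & forall eps, 0 < eps -> exists2 dlt, 0 < dlt &
    forall t, 0 < t -> t < dlt ->
      nrm m p (fun x => f x - T t f x - t * h x) <= eps * t].
Proof.
move=> p1.
suff H : inLp m p f -> inLp m p h -> forall t, 0 < t ->
    Lpdist m p (fun x => (f x - T t f x) / t) h =
    (t^-1 * nrm m p (fun x => f x - T t f x - t * h x))%:E.
  have H0 t : (0 <= Lpdist m p (fun x => (f x - T t f x) / t)%R h)%E by exact: Lnorm_ge0.
  split=> [[Lf [Lh /cvg0_at_right K]]|[Lf Lh K]].
    split=> // eps /(K (fun t _ => H0 t))[dlt dlt0 {}K]; exists dlt => // t t0 /(K t t0).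
    by rewrite H// lee_fin ler_pdivrMl// mulrC.
  split=> //; split=> //; apply/cvg0_at_right => // eps /K[dlt dlt0 {}K].
  exists dlt => // t t0 /(K t t0).
  by rewrite H// lee_fin ler_pdivrMl// mulrC.
move=> Lf Lh t t0; have LTf := T_inLp p1 (ltW t0) Lf.
rewrite (_ : (fun x => (f x - T t f x) / t) = fun x => t^-1 * (f x - T t f x)); last first.
  by apply/funext => x; rewrite mulrC.
have LB := inLpB p1 Lf LTf.
rewrite Lpdist_nrm//; last exact: inLpZ.
have -> : t^-1 = `|t^-1| by rewrite gtr0_norm ?invr_gt0.
rewrite -nrmZ//; last by apply: inLpB => //; exact: inLpZ.
rewrite gtr0_norm ?invr_gt0//.
congr (_%:E); congr nrm; apply/funext => x.
by field; rewrite gt_eqF.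
Qed.

End semigroup.

(** * Resolvents of a Dirichlet form *)

Section form.
Context {d : measure_display} {X : measurableType d} {R : realType}.
Variable m : {measure set X -> \bar R}.
Variables (D : set (X -> R)) (E : (X -> R) -> (X -> R) -> R).
Hypothesis DF : dirichlet_form m D E.
Implicit Types (f g h u v w : X -> R) (a b c eps dlt : R).

Let p12 : (1 : R) <= 2. Proof. by rewrite ler1n. Qed.

Lemma D_inLp f : D f -> inLp m 2 f.
Proof. by move: DF => [+ _]; apply. Qed.

Lemma D_linear a f g : D f -> D g -> D (fun x => a * f x + g x).
Proof. by move: DF => [_ [_ [+ _]]]; apply. Qed.

Lemma E_linear a f g h : D f -> D g -> D h ->
  E (fun x => a * f x + g x) h = a * E f h + E g h.
Proof. by move: DF => [_ [_ [_ [+ _]]]]; apply. Qed.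

Lemma E_sym f g : D f -> D g -> E f g = E g f.
Proof. by move: DF => [_ [_ [_ [_ [+ _]]]]]; apply. Qed.

Lemma E_ge0 f : D f -> 0 <= E f f.
Proof. by move: DF => [_ [_ [_ [_ [_ [+ _]]]]]]; apply. Qed.

Lemma D_dense f : inLp m 2 f -> forall eps, 0 < eps ->
  exists2 g, D g & nrm m 2 (fun x => f x - g x) <= eps.
Proof.
move: DF => [_ [_ [_ [_ [_ [_ [+ _]]]]]]] Lf eps e0.
move=> /(_ f Lf eps e0)[g [Dg]]; rewrite Lpdist_nrm//; last exact: D_inLp.
by rewrite lte_fin => /ltW; exists g.
Qed.

Lemma E1E f : D f -> E1 m E f = E f f + pairing m f f.
Proof.
move=> Df; have Lf := D_inLp Df; rewrite /E1 pairing_sqr// Lpdist_nrm//; last exact: inLp0.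
by congr (_ + nrm _ _ _ ^+ 2); apply/funext => x; rewrite subr0.
Qed.

Lemma D_zero : D (fun=> 0).
Proof.
(* Density supplies some element of [D], and linearity turns it into [g - g]. *)
have [g Dg _] := D_dense (inLp0 m p12) ltr01.
rewrite (_ : (fun=> 0) = fun x => -1 * g x + g x); first exact: D_linear.
by apply/funext => x; ring.
Qed.

Lemma D_sub f g : D f -> D g -> D (fun x => f x - g x).
Proof.
move=> Df Dg; rewrite (_ : (fun x => f x - g x) = fun x => -1 * g x + f x).
  exact: D_linear.
by apply/funext => x; ring.
Qed.

(** The shifted form E_a, whose Riesz representation yields the resolvent a (a + L)^-1. *)
Definition Eform a f g := E f g + a * pairing m f g.

Lemma Eform_linearl a b f g h : D f -> D g -> D h ->
  Eform a (fun x => b * f x + g x) h = b * Eform a f h + Eform a g h.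
Proof.
move=> Df Dg Dh; have [Lf Lg Lh] := And3 (D_inLp Df) (D_inLp Dg) (D_inLp Dh).
rewrite /Eform E_linear// pairingDl//; last exact: inLpZ.
by rewrite pairingZl//; ring.
Qed.

Lemma Eform_sym a f g : D f -> D g -> Eform a f g = Eform a g f.
Proof. by move=> Df Dg; rewrite /Eform E_sym// pairingC. Qed.

Lemma Eform_expand a b f g : D f -> D g ->
  Eform a (fun x => b * f x + g x) (fun x => b * f x + g x) =
  b ^+ 2 * Eform a f f + 2 * b * Eform a f g + Eform a g g.
Proof.
move=> Df Dg; have Dfg := D_linear b Df Dg.
rewrite Eform_linearl// !(Eform_sym _ _ Dfg)// !Eform_linearl//.
by rewrite (Eform_sym _ Dg Df); ring.
Qed.

Lemma E_expand b f g : D f -> D g ->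
  E (fun x => b * f x + g x) (fun x => b * f x + g x) =
  b ^+ 2 * E f f + 2 * b * E f g + E g g.
Proof.
move=> Df Dg; have := Eform_expand 0 b Df Dg.
by rewrite /Eform !mul0r !addr0.
Qed.

Lemma Eform_ge0 a f : 0 <= a -> D f -> 0 <= Eform a f f.
Proof.
move=> a0 Df; rewrite addr_ge0 ?E_ge0// mulr_ge0//.
by rewrite pairing_sqr ?sqr_ge0//; exact: D_inLp.
Qed.

(* Riesz representation: the minimizers of v |-> E_a(v, v) - 2 a <f, v> converge
   for the form norm, by the parallelogram law. *)
Lemma resolvent_exists a f : 1 <= a -> inLp m 2 f -> exists2 u, D u &
  forall v, D v -> E u v = pairing m (fun x => a * (f x - u x)) v.
Proof.
move=> a1 Lf; have a0 : 0 <= a by exact: le_trans a1.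
pose F v := Eform a v v - 2 * a * pairing m f v.
have F_line b v w : D v -> D w -> F (fun x => b * w x + v x) =
    F v + 2 * b * (Eform a v w - a * pairing m f w) + b ^+ 2 * Eform a w w.
  move=> Dv Dw; have [Lv Lw] := conj (D_inLp Dv) (D_inLp Dw).
  rewrite /F Eform_expand// pairingDr//; last exact: inLpZ.
  by rewrite pairingZr// (Eform_sym a Dw Dv); ring.
pose S : set R := [set F v | v in D].
have S0 : S !=set0 by exists (F (fun=> 0)), (fun=> 0) => //; exact: D_zero.
(* Completing the square: [a |v|^2 - 2 a |f| |v|] is at least [- a |f|^2]. *)
have F_lb v : D v -> - a * nrm m 2 f ^+ 2 <= F v.
  move=> Dv; have Lv := D_inLp Dv.
  have h1 := pairing_le_nrm Lf Lv; have h2 := E_ge0 Dv.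
  rewrite /F /Eform pairing_sqr//.
  have h3 : 0 <= a * (nrm m 2 f - nrm m 2 v) ^+ 2 by rewrite mulr_ge0 ?sqr_ge0.
  have h4 : a * pairing m f v <= a * (nrm m 2 f * nrm m 2 v) by rewrite ler_wpM2l.
  lra.
have Slb : has_lbound S by exists (- a * nrm m 2 f ^+ 2) => _ [v Dv <-]; exact: F_lb.
pose j := inf S.
have jF v : D v -> j <= F v by move=> Dv; apply: ge_inf => //; exists v.
have /choice[v Hv] : forall n : nat, exists v, D v /\ F v < j + n.+1%:R^-1.
  move=> n; have n0 : 0 < n.+1%:R^-1 :> R by rewrite invr_gt0.
  have [_ [v Dv <-] lt] := inf_adherent n0 (conj S0 Slb).
  by exists v.
have Dv n : D (v n) by case: (Hv n).
have Fv n : F (v n) < j + n.+1%:R^-1 by case: (Hv n).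
move: (j) jF Fv {Hv} => {}j jF Fv.
(* The midpoint of [v n] and [v k] has value at least [j], so the parallelogram law bounds the form
   of the difference by twice the sum of the two defects; [1 <= a] makes [Eform a] dominate [E1]. *)
have Cauchy n k : E1 m E (v n \- v k) <= 2 * (n.+1%:R^-1 + k.+1%:R^-1).
  have Dnk := D_sub (Dv n) (Dv k); rewrite E1E//=.
  have P0 : 0 <= pairing m (v n \- v k) (v n \- v k).
    by rewrite pairing_sqr ?sqr_ge0//; exact: (D_inLp Dnk).
  have le : E (v n \- v k) (v n \- v k) + pairing m (v n \- v k) (v n \- v k)
      <= Eform a (v n \- v k) (v n \- v k).
    by rewrite lerD2l -[leLHS]mul1r ler_wpM2r.
  have Dnk2 : D (fun x => 2^-1 * (v n x - v k x) + v k x) by exact: D_linear.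
  have h1 := F_line (2^-1) _ _ (Dv k) Dnk; have h2 := F_line 1 _ _ (Dv k) Dnk.
  rewrite (_ : (fun x => 1 * (v n x - v k x) + v k x) = v n) in h2; last first.
    by apply/funext => x; ring.
  have h3 := jF _ Dnk2; have [h4 h5] := conj (Fv n) (Fv k).
  apply: (le_trans le); rewrite -[v n \- v k]/(fun x => v n x - v k x).
  move: n.+1%:R^-1 k.+1%:R^-1 h4 h5 => y z h4 h5.
  lra.
have : exists u, D u /\ (fun n => E1 m E (v n \- u)) @ \oo --> 0.
  move: DF => [_ [_ [_ [_ [_ [_ [_ [+ _]]]]]]]]; apply => // eps eps0.
  have [N _ HN] : \forall n \near \oo, n.+1%:R^-1 < eps / 4 :> R.
    have e4 : 0 < eps / 4 by rewrite divr_gt0.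
    exact: near_infty_natSinv_lt (PosNum e4).
  exists N => n k Nn Nk; apply: le_lt_trans (Cauchy n k) _.
  have := HN n Nn; have := HN k Nk; rewrite /=.
  by move: n.+1%:R^-1 k.+1%:R^-1 => y z; lra.
move=> [u [Du cvgu]]; exists u => // w Dw; have [Lu Lw] := conj (D_inLp Du) (D_inLp Dw).
have LfZ b : inLp m 2 (fun x => b * f x) by exact: inLpZ.
pose B := Eform a u w - a * pairing m f w.
suff : B = 0.
  rewrite /B /Eform pairingZl//; last exact: inLpB.
  by rewrite pairingBl//; lra.
pose W := Eform a w w; have W0 : 0 <= W by exact: Eform_ge0.
(* [v n] is compared with its perturbation by [t w]. The cross term with [z = v n - u] is absorbed
   by nonnegativity of the form at [z - t w], which produces the factor 2 before [t ^+ 2 * W]; what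
   remains, the defect of [v n] and the form of [z], costs [eps / 2] each. *)
have key_eps t (eps : R) : 0 < eps -> 0 <= eps + (2 * t * B + 2 * t ^+ 2 * W).
  move=> eps0.
  have [n [H1 H2]] : exists n, E1 m E (v n \- u) < eps / (2 * a) /\
      n.+1%:R^-1 < eps / 2 :> R.
    have e2 : 0 < eps / 2 by rewrite divr_gt0.
    have e2a : 0 < eps / (2 * a) by rewrite divr_gt0// mulr_gt0// (lt_le_trans ltr01).
    move/cvgr0Pnorm_lt : cvgu => /(_ _ e2a) c1.
    have [N _ HN] := filterI c1 (near_infty_natSinv_lt (PosNum e2)).
    have [h1 h2] := HN N (leqnn N).
    by exists N; split=> //; apply: le_lt_trans (ler_norm _) h1.
  have Dz := D_sub (Dv n) Du.
  have H3 : a * E1 m E (v n \- u) <= eps / 2.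
    by move/ltW: H1; rewrite ler_pdivlMr ?mulr_gt0 ?(lt_le_trans ltr01 a1)//; lra.
  have H4 : Eform a (fun x => v n x - u x) (fun x => v n x - u x) <= a * E1 m E (v n \- u).
    rewrite E1E//= /Eform mulrDr lerD2r.
    by rewrite -[leLHS]mul1r ler_wpM2r// E_ge0.
  have H5 := Eform_ge0 a0 (D_linear (- t) Dw Dz).
  rewrite Eform_expand// in H5.
  have H6 := jF _ (D_linear t Dw (Dv n)).
  rewrite F_line// in H6.
  have H7 : Eform a (v n) w = Eform a w (fun x => v n x - u x) + Eform a u w.
    rewrite (Eform_sym a Dw Dz).
    have := Eform_linearl a 1 Dz Du Dw; rewrite mul1r => <-.
    by congr Eform; apply/funext => x; ring.
  have H8 := Fv n.
  rewrite -/W in H5 H6; rewrite H7 in H6; rewrite /B.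
  move: (E1 m E _) n.+1%:R^-1 (Eform a _ (fun x => v n x - u x)) H2 H3 H4 H5 H6 H8.
  move=> e y q H2 H3 H4 H5 H6 H8.
  lra.
have key t : 0 <= 2 * t * B + 2 * t ^+ 2 * W by apply/ler_addgt0Pl; exact: key_eps.
(* Dividing by [W + 1] avoids the case [W = 0]. At [t = - b / 2] the bound reads 0 <= - b^2 (W / 2 +
   1), which forces [b = 0]. *)
have W1 : W + 1 != 0 by rewrite gt_eqF// ltr_wpDl.
pose b := B / (W + 1); have Bb : B = b * (W + 1) by rewrite /b divfK.
have := key (- b / 2); rewrite Bb => H.
have : b ^+ 2 <= 0 by have := sqr_ge0 b; nra.
by rewrite exprn_even_le0//= => /eqP ->; rewrite mul0r.
Qed.

Lemma cut_contraction c : 0 <= c -> normal_contraction (fun s : R => Num.min s c).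
Proof.
move=> c0; split=> [|s t]; first by rewrite min_l.
have h1 := ler_norm (s - t); have := ler_norm (t - s); rewrite (distrC t s) => h2.
have h0 := normr_ge0 (s - t); rewrite ler_norml !minEle.
by case: (leP s c) => ?; case: (leP t c) => ?; lra.
Qed.

Lemma D_cut c f : 0 <= c -> D f -> D (fun x => Num.min (f x) c).
Proof.
move=> /cut_contraction C Df.
by move: DF => [_ [_ [_ [_ [_ [_ [_ [_ M]]]]]]]]; case: (M _ _ C Df).
Qed.

(* The Markov property E(u - w) <= E(u) gives E(w) <= 2 E(u, w). *)
Lemma E_excess_ge0 c u : 0 <= c -> D u -> 0 <= E u (fun x => u x - Num.min (u x) c).
Proof.
move=> c0 Du; have Dw := D_sub Du (D_cut c0 Du).
have : E (fun x => Num.min (u x) c) (fun x => Num.min (u x) c) <= E u u.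
  move: DF => [_ [_ [_ [_ [_ [_ [_ [_ M]]]]]]]].
  by case: (M _ _ (cut_contraction c0) Du).
pose w x := u x - Num.min (u x) c; rewrite -/w in Dw *.
rewrite (_ : (fun x => Num.min (u x) c) = fun x => -1 * w x + u x); last first.
  by apply/funext => x; rewrite /w; ring.
rewrite E_expand// (E_sym Dw Du); have := E_ge0 Dw.
by move: (E w w) (E u w) (E u u) => *; lra.
Qed.

Lemma excess_norm_le c (s : R) : 0 <= c -> `|s - Num.min s c| <= `|s|.
Proof.
move=> c0; rewrite minEle; case: (leP s c) => sc; first by rewrite subrr normr0.
by rewrite !ger0_norm; lra.
Qed.

(** Here u = a (a + L)^-1 g and h = L u = a (g - u). Testing the equation with [u - g] gives a |u -
    g|^2 <= E(g, g) / 4, hence the size of [a], with 1 added to meet the condition [1 <= a]. The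
    same [u] serves all bounds c. *)
Lemma resolvent_approx g : D g -> forall eps, 0 < eps ->
  exists u h, [/\ assoc_op m D E u h, nrm m 2 (fun x => u x - g x) <= eps &
    forall c, 0 <= c -> (forall x, g x <= c) -> {ae m, forall x, u x <= c}].
Proof.
move=> Dg eps eps0; have Lg := D_inLp Dg.
pose a := 1 + E g g / eps ^+ 2; have Egg := E_ge0 Dg.
have e2 : 0 < eps ^+ 2 by rewrite exprn_gt0.
have a1 : 1 <= a by rewrite lerDl divr_ge0// ltW.
have a0 : 0 <= a by exact: le_trans a1.
have [u Du solu] := resolvent_exists a1 Lg; have Lu := D_inLp Du.
have Lgu := inLpB p12 Lg Lu.
have Lh : inLp m 2 (fun x => a * (g x - u x)) by exact: inLpZ.
exists u, (fun x => a * (g x - u x)); split => //.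
- have Dug := D_sub Du Dg; have := solu _ Dug; have Lug := D_inLp Dug.
  rewrite pairingZl// (_ : (fun x => g x - u x) = fun x => -1 * (u x - g x)); last first.
    by apply/funext => x; ring.
  rewrite pairingZl// pairing_sqr// => h1.
  (* Nonnegativity at g/2 + (u - g) bounds E(g, u - g) + E(u - g, u - g) below by - E(g, g) / 4. *)
  have h2 := E_ge0 (D_linear (1/2) Dg Dug); rewrite E_expand// in h2.
  have := E_linear 1 Dug Dg Dug.
  rewrite (_ : (fun x => 1 * (u x - g x) + g x) = u); last by apply/funext => x; ring.
  rewrite h1 => h3.
  have h4 : a * nrm m 2 (fun x => u x - g x) ^+ 2 <= E g g / 4.
    by move: (nrm _ _ _ ^+ 2) (E g _) (E (fun x => _) _) h2 h3 => *; lra.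
  rewrite -(@ler_pXn2r _ 2)// ?nnegrE ?nrm_ge0 ?(ltW eps0)//.
  have aE : a * eps ^+ 2 = eps ^+ 2 + E g g by rewrite /a mulrDl mul1r divfK// gt_eqF.
  rewrite -(@ler_pM2l _ a) ?(lt_le_trans ltr01 a1)//; lra.
- move=> c c0 gc; have Dw := D_sub Du (D_cut c0 Du).
  have Lw := D_inLp Dw; have Ew := E_excess_ge0 c0 Du.
  pose w x := u x - Num.min (u x) c; rewrite -/w in Dw Lw Ew.
  (* Where [w] is nonzero, u > c >= g, so u - g >= w. With E(u, w) >= 0 this gives 0 <= - a
     |w|^2. *)
  have : pairing m (fun x => a * (g x - u x)) w <= pairing m (fun x => - a * w x) w.
    apply: pairing_le => //; first exact: inLpZ.
    move=> x; rewrite -!mulrA mulNr lerNr -mulrN ler_wpM2l//.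
    rewrite /w minEle; case: (leP (u x) c) => uc; first by rewrite subrr !mulr0 oppr0.
    by have := gc x; nra.
  rewrite -solu// pairingZl// pairing_sqr// => le.
  have a_gt0 : 0 < a by rewrite (lt_le_trans ltr01).
  have : nrm m 2 w = 0.
    apply/eqP; rewrite -sqrf_eq0 eq_le sqr_ge0 andbT -(pmulr_rle0 _ a_gt0).
    by move: (nrm _ _ _ ^+ 2) (E u w) Ew le => *; lra.
  move/(nrm_eq0 p12 Lw); apply: filterS => x; rewrite /w minEle.
  by case: (leP (u x) c) => // uc /eqP; rewrite subr_eq0 gt_eqF.
Qed.

End form.

(** * The sub-Markov property and symmetry *)

(** Cut [0, t] into equal steps shorter than [dlt]; applied with rate [eps / t], the errors add up
    to [eps]. Since [dlt] does not depend on [s], no differentiability or compactness enters. *)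
Lemma uniform_dini_le (R : realType) (F : R -> R) (t : R) : 0 <= t ->
  (forall eps : R, 0 < eps -> exists2 dlt : R, 0 < dlt & forall s r : R, 0 <= s ->
     0 < r -> r < dlt -> s + r <= t -> F (s + r) <= F s + eps * r) ->
  F t <= F 0.
Proof.
rewrite le_eqVlt => /predU1P[<-//|t0 H].
have key (eps : R) : 0 < eps -> F t <= F 0 + eps.
  move=> eps0; have [dlt dlt0 {}H] := H _ (divr_gt0 eps0 t0).
  have [N _ HN] := near_infty_natSinv_lt (PosNum (divr_gt0 dlt0 t0)).
  have /= {}HN := HN N (leqnn N).
  pose n := N.+1; pose r := t / n%:R.
  have n0 : 0 < n%:R :> R by rewrite ltr0n.
  have r0 : 0 < r by rewrite divr_gt0.
  have rdlt : r < dlt by rewrite /r mulrC -ltr_pdivlMr.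
  have nr : n%:R * r = t by rewrite mulrC divfK// gt_eqF.
  have ind k : (k <= n)%N -> F (k%:R * r) <= F 0 + k%:R * (eps / t * r).
    elim: k => [|k IH] kn; first by rewrite !mul0r addr0.
    rewrite -natr1 !mulrDl !mul1r addrA.
    apply: le_trans (H _ _ _ r0 rdlt _) _; first by rewrite mulr_ge0// ltW.
      by rewrite -[X in _ + X]mul1r -mulrDl natr1 -nr ler_wpM2r ?ler_nat// ltW.
    by rewrite lerD2r IH// ltnW.
  have := ind n (leqnn n); rewrite nr; move=> /le_trans; apply.
  by rewrite lerD2l mulrCA nr divfK// gt_eqF.
by apply/ler_addgt0Pr => eps eps0; exact: key.
Qed.

Section closure.
Context {d : measure_display} {X : measurableType d} {R : realType}.
Variable m : {measure set X -> \bar R}.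
Implicit Types (f g h u v w : X -> R) (p a b c eps dlt : R).

Lemma measurable_cut f c : measurable_fun setT f ->
  measurable_fun setT (fun x => Num.min (f x) c).
Proof. by move=> mf; apply: measurable_minr. Qed.

Lemma cut_norm_le c (s : R) : 0 <= c -> `|Num.min s c| <= `|s|.
Proof.
by move=> c0; rewrite minEle; case: (leP s c) => // sc; rewrite !ger0_norm; lra.
Qed.

Lemma inLp_cut p f c : 1 <= p -> 0 <= c -> inLp m p f ->
  inLp m p (fun x => Num.min (f x) c).
Proof.
move=> p1 c0 Lf; apply: (inLp_dom p1 _ Lf) => [|x]; last exact: cut_norm_le.
exact/measurable_cut/(inLp_meas Lf).
Qed.

(** Among functions below c the cut of f at c is pointwise nearest to f, so its distance to f is at
    most that of any [g]. *)
Lemma le_closed p c f : 1 <= p -> 0 <= c -> inLp m p f ->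
  (forall eps, 0 < eps -> exists g, [/\ inLp m p g, {ae m, forall x, g x <= c} &
     nrm m p (fun x => f x - g x) <= eps]) ->
  {ae m, forall x, f x <= c}.
Proof.
move=> p1 c0 Lf H; have Lc := inLp_cut p1 c0 Lf.
have Lw := inLpB p1 Lf Lc.
have : aeeq m f (fun x => Num.min (f x) c).
  apply: (aeeq_nrm_small p1 Lf Lc) => eps /H[g [Lg gc fg]].
  apply: le_trans fg.
  have [] // := inLp_le p1 (inLp_meas Lw) (inLpB p1 Lf Lg).
  apply: filterS gc => x gc; rewrite minEle; case: (leP (f x) c) => fc.
    by rewrite subrr normr0.
  by rewrite !ger0_norm; lra.
by apply: filterS => x ->; rewrite ge_min lexx orbT.
Qed.

End closure.

Section markov_semigroup.
Context {d : measure_display} {X : measurableType d} {R : realType}.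
Variable m : {measure set X -> \bar R}.
Variables (D : set (X -> R)) (E : (X -> R) -> (X -> R) -> R).
Variable T : R -> (X -> R) -> (X -> R).
Hypothesis DF : dirichlet_form m D E.
Hypothesis TS : assoc_semigroup m D E T.
Implicit Types (f g h u v w : X -> R) (p a b c s t r eps dlt : R).

Let p12 : (1 : R) <= 2. Proof. by rewrite ler1n. Qed.

Lemma generatorP u h : assoc_op m D E u h <-> gen_rel m 2 T u h.
Proof.
move: TS => [_ [_ [_ [_ H]]]]; split=> [|[Lu [Lh K]]]; last exact/H.
by move=> [Du [Lh K]]; apply/H => //; exact: (D_inLp DF).
Qed.

(** [T s] commutes with [T r] and contracts, so applying it to the expansion at time 0 gives the
    expansion at time s with the same [dlt]. *)
Lemma generator_uniform u h : assoc_op m D E u h ->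
  forall eps, 0 < eps -> exists2 dlt, 0 < dlt & forall s r, 0 <= s -> 0 < r ->
    r < dlt -> nrm m 2 (fun x => T s u x - T r (T s u) x - r * T s h x) <= eps * r.
Proof.
move=> /generatorP /(gen_relP TS _ _ p12)[Lu Lh H] eps /H[dlt dlt0 {}H].
exists dlt => // s r s0 r0 rdlt; apply: le_trans (H r r0 rdlt).
have TL := T_inLp TS p12; have rge0 := ltW r0.
have Ltu := TL _ _ rge0 Lu; have Lrh := inLpZ r p12 Lh.
have LB := inLpB p12 (inLpB p12 Lu Ltu) Lrh.
have Lsu := TL _ _ s0 Lu; have Lrsu := TL _ _ rge0 Lsu.
have Lsh := TL _ _ s0 Lh.
apply: le_trans (T_contract TS p12 s0 LB).
have mB := inLp_meas (inLpB p12 (inLpB p12 Lsu Lrsu) (inLpZ r p12 Lsh)).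
have [//|_ -> //] := nrm_ae p12 mB (TL _ _ s0 LB).
have e1 := T_sub TS p12 s0 (inLpB p12 Lu Ltu) Lrh.
have e2 := T_sub TS p12 s0 Lu Ltu.
have e3 := T_scale TS r p12 s0 Lh.
have e4 := T_semigroup TS p12 s0 rge0 Lu; rewrite addrC in e4.
have e5 := T_semigroup TS p12 rge0 s0 Lu.
move: (aeeq_trans (aeeq_sym e5) e4) => e6.
by apply: filterS3 (aeeq_trans e1 (aeeq_refl m _)) (filterI e2 e3) e6 => x -> [-> ->] ->.
Qed.

Lemma generator_T u h s : 0 <= s -> assoc_op m D E u h ->
  assoc_op m D E (T s u) (T s h).
Proof.
move=> s0 uh; have H := generator_uniform uh.
have /generatorP /(gen_relP TS _ _ p12)[Lu Lh _] := uh.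
apply/generatorP/(gen_relP TS _ _ p12); split; [exact: (T_inLp TS p12)..|].
by move=> eps /H[dlt dlt0 {}H]; exists dlt => // t t0 tdlt; exact: H.
Qed.

Let excess c v x := v x - Num.min (v x) c.

Let inLp_excess c v : 0 <= c -> inLp m 2 v -> inLp m 2 (excess c v).
Proof. by move=> c0 Lv; apply: inLpB => //; exact: inLp_cut. Qed.

Let nrm_excess_ae c u v : 0 <= c -> inLp m 2 u -> inLp m 2 v -> aeeq m u v ->
  nrm m 2 (excess c u) = nrm m 2 (excess c v).
Proof.
move=> c0 Lu Lv uv.
have Leu := inLp_excess c0 Lu; have Lev := inLp_excess c0 Lv.
have [//|_ ->//] := nrm_ae p12 (inLp_meas Leu) Lev.
by apply: filterS uv => x; rewrite /excess => ->.
Qed.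

(** Taylor bound for the square of the positive part of s - c: its derivative is twice the excess
    and is Lipschitz with constant 2. *)
Lemma excess_sqr_le c (s t : R) : (t - Num.min t c) ^+ 2 <=
  (s - Num.min s c) ^+ 2 + 2 * ((s - Num.min s c) * (t - s)) + (t - s) ^+ 2.
Proof.
have h1 := sqr_ge0 (t - s); have h2 := sqr_ge0 (t - c).
rewrite !minEle; case: (leP s c) => sc; case: (leP t c) => tc.
- by rewrite !subrr; lra.
- have : 0 <= (c - s) * (t - c) by rewrite mulr_ge0 ?subr_ge0// ltW.
  by have := sqr_ge0 (c - s); lra.
- by rewrite subrr; lra.
- by lra.
Qed.

Lemma nrm_excess_step c u v : 0 <= c -> inLp m 2 u -> inLp m 2 v ->
  nrm m 2 (excess c v) ^+ 2 <= nrm m 2 (excess c u) ^+ 2 +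
    2 * pairing m (excess c u) (fun x => v x - u x) +
    nrm m 2 (fun x => v x - u x) ^+ 2.
Proof.
move=> c0 Lu Lv; have Lvu := inLpB p12 Lv Lu.
have Lu' := inLp_excess c0 Lu; have Lv' := inLp_excess c0 Lv.
rewrite -!pairing_sqr// -lee_fin !EFinD -!pairingE// EFinM -pairingE//.
have I := @pairing_integrable _ _ _ m.
rewrite -integralZl//; last exact: I.
have I1 := I _ _ Lu' Lu'; have I2 := I _ _ Lu' Lvu; have I3 := I _ _ Lvu Lvu.
have I4 := integrableZl measurableT 2 I2.
rewrite -integralD// -integralD//; last exact: integrableD.
apply: le_integral => //; [exact: I|by apply: integrableD => //; exact: integrableD|].
move=> x _; rewrite -!EFinM -!EFinD lee_fin -!expr2.
exact: excess_sqr_le.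
Qed.

(* The squared norm of the excess of T_s u over c has nonpositive derivative
   - 2 E(T_s u, excess), so it stays zero. *)
Lemma submarkov_generator c u h t : 0 <= c -> 0 <= t -> assoc_op m D E u h ->
  {ae m, forall x, u x <= c} -> {ae m, forall x, T t u x <= c}.
Proof.
move=> c0 t0 uh uc; have TL := T_inLp TS p12.
have /generatorP /(gen_relP TS _ _ p12)[Lu Lh _] := uh.
pose F s := nrm m 2 (excess c (T s u)) ^+ 2.
have F0 : F 0 = 0.
  rewrite /F (nrm_excess_ae c0 (TL _ _ (lexx 0) Lu) Lu (T0_id TS p12 Lu)).
  have := nrm_dist_ae p12 Lu (inLp_cut p12 c0 Lu); rewrite /excess => ->.
    by rewrite expr0n.
  by apply: filterS uc => x uc; rewrite min_l.
(* The remainder of the expansion costs [2 |u| e r]. The quadratic term costs [r^2 (|h| + e)^2], at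
   most [r e (|h| + 1)^2] when [r <= e <= 1]. The final 1 keeps [K] positive. *)
pose K := 2 * nrm m 2 u + (nrm m 2 h + 1) ^+ 2 + 1.
have [nu0 nh0] := conj (nrm_ge0 m 2 u) (nrm_ge0 m 2 h).
have K0 : 0 < K by rewrite /K; nra.
have : F t <= F 0.
  apply: uniform_dini_le => // eps eps0.
  pose e := Num.min 1 (eps / K).
  have e0 : 0 < e by rewrite lt_min ltr01 divr_gt0.
  have e1 : e <= 1 by rewrite ge_min lexx.
  have eK : K * e <= eps by rewrite mulrC -ler_pdivlMr// ge_min lexx orbT.
  move: (e) e0 e1 eK => {}e e0 e1 eK.
  have [dlt dlt0 H] := generator_uniform uh e0.
  exists (Num.min dlt e); first by rewrite lt_min dlt0.
  move=> s r s0 r0; rewrite lt_min => /andP[rdlt re] _; have rge0 := ltW r0.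
  have {H} := H s r s0 r0 rdlt; have uhs := generator_T s0 uh.
  have Lsu := TL _ _ s0 Lu; have Lrsu := TL _ _ rge0 Lsu; have Lsh := TL _ _ s0 Lh.
  have Du : D (T s u) by case: uhs.
  have Lw := inLp_excess c0 Lsu.
  have Dw : D (excess c (T s u)) by apply: (D_sub DF) => //; exact: (D_cut DF).
  have Ew := E_excess_ge0 DF c0 Du; rewrite -/(excess c (T s u)) in Ew.
  have {uhs} : E (T s u) (excess c (T s u)) = pairing m (T s h) (excess c (T s u)).
    by case: uhs => _ [_]; apply.
  have step := nrm_excess_step c0 Lsu Lrsu.
  have nsu := T_contract TS p12 s0 Lu; have nsh := T_contract TS p12 s0 Lh.
  have nw : nrm m 2 (excess c (T s u)) <= nrm m 2 (T s u).
    have [] // := inLp_le p12 (inLp_meas Lw) Lsu.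
    by apply: aeW => x; exact: excess_norm_le.
  rewrite /F (addrC s r) (nrm_excess_ae c0 (TL _ _ _ Lu) Lrsu (T_semigroup TS p12 rge0 s0 Lu)); last first.
    by rewrite addr_ge0.
  move=> EaL nrho; apply: le_trans step _; rewrite -addrA lerD2l.
  move: (T s u) (T s h) (T r (T s u)) Lsu Lrsu Lsh Lw Ew nsu nsh nw EaL nrho {Du Dw}.
  move=> a La b aL bL LaL wL Ew nsu nsh nw EaL.
  set rho := (fun x => a x - b x - r * La x) => nrho.
  have rhoL : inLp m 2 rho by apply: inLpB => //; [exact: inLpB|exact: inLpZ].
  have LaZ := inLpZ r p12 LaL.
  have baE : (fun x => b x - a x) = (fun x => - (r * La x) - rho x).
    by apply/funext => x; rewrite /rho; ring.
  (* The main part of [b - a] is [- r La]; its pairing with the excess is [- r * E a (excess c a)],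
     which is nonpositive and dropped. Only the remainder [rho] counts. *)
  have h1 : pairing m (excess c a) (fun x => b x - a x) <= nrm m 2 u * (e * r).
    rewrite baE pairingBr//; last exact: inLpN.
    rewrite pairingC pairingNl// pairingZl// -EaL.
    have := pairing_CS wL rhoL; rewrite ler_norml => /andP[h2 _].
    have h3 : nrm m 2 (excess c a) * nrm m 2 rho <= nrm m 2 u * (e * r).
      by rewrite ler_pM ?nrm_ge0//; apply: le_trans nw _.
    have h4 : 0 <= r * E a (excess c a) by rewrite mulr_ge0.
    apply: (@le_trans _ _ (- pairing m (excess c a) rho)).
      by rewrite lerBlDr addNr oppr_le0.
    by rewrite lerNl; apply: le_trans h2; rewrite lerN2.
  have h2 : nrm m 2 (fun x => b x - a x) <= r * (nrm m 2 h + e).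
    rewrite baE; apply: le_trans (nrmB p12 (inLpN p12 LaZ) rhoL) _.
    rewrite nrmN// nrmZ// gtr0_norm// mulrDr (mulrC r e) lerD//.
    by rewrite ler_wpM2l.
  have h3 : nrm m 2 (fun x => b x - a x) ^+ 2 <= r * e * (nrm m 2 h + 1) ^+ 2.
    have he0 : 0 <= nrm m 2 h + e by rewrite addr_ge0 // ltW.
    have h10 : 0 <= nrm m 2 h + 1 by rewrite addr_ge0.
    apply: (@le_trans _ _ ((r * (nrm m 2 h + e)) ^+ 2)).
      by rewrite ler_pXn2r// nnegrE ?nrm_ge0// mulr_ge0.
    rewrite exprMn ler_pM ?sqr_ge0//; first by rewrite expr2 ler_wpM2l// ltW.
    by rewrite ler_pXn2r// lerD2l.
  have h4 : K * e * r <= eps * r by rewrite ler_wpM2r.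
  move: h4; rewrite /K; move: (pairing _ _ _) h1 (nrm _ _ _ ^+ 2) h3 => P h1 Q h3 h4.
  have h5 : 0 <= e * r by rewrite mulr_ge0 ?ltW.
  by lra.
rewrite F0 /F => F_le0.
have /eqP : nrm m 2 (excess c (T t u)) ^+ 2 = 0.
  by apply/eqP; rewrite eq_le F_le0 sqr_ge0.
rewrite sqrf_eq0 => /eqP /(nrm_eq0 p12 (inLp_excess c0 (TL _ _ t0 Lu))).
apply: filterS => x /eqP; rewrite subr_eq0 => /eqP ->.
by rewrite ge_min lexx orbT.
Qed.

(** The function s -> <T_s u, T_(t-s) v> has zero derivative because the form is symmetric. One
    inequality suffices, the other coming from exchanging u and v. *)
Lemma generator_symmetric_le u h v k t : 0 <= t ->
  assoc_op m D E u h -> assoc_op m D E v k ->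
  pairing m (T t u) v <= pairing m u (T t v).
Proof.
move=> t0 uh vk; have TL := T_inLp TS p12.
have /generatorP /(gen_relP TS _ _ p12)[Lu Lh _] := uh.
have /generatorP /(gen_relP TS _ _ p12)[Lv Lk _] := vk.
pose F s := pairing m (T s u) (T (t - s) v).
have -> : pairing m (T t u) v = F t.
  rewrite /F subrr; apply: pairing_ae => //; [exact: TL..|exact: aeeq_refl|].
  exact: aeeq_sym (T0_id TS p12 Lv).
have -> : pairing m u (T t v) = F 0.
  rewrite /F subr0; apply: pairing_ae => //; [exact: TL..| |exact: aeeq_refl].
  exact: aeeq_sym (T0_id TS p12 Lu).
have [nu0 nv0] := conj (nrm_ge0 m 2 u) (nrm_ge0 m 2 v).
have K0 : 0 < nrm m 2 u + nrm m 2 v + 1 by rewrite ltr_wpDl// addr_ge0.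
apply: uniform_dini_le => // eps eps0; have e0 := divr_gt0 eps0 K0.
have [dlt1 dlt10 H1] := generator_uniform uh e0.
have [dlt2 dlt20 H2] := generator_uniform vk e0.
exists (Num.min dlt1 dlt2); first by rewrite lt_min dlt10.
move=> s r s0 r0; rewrite lt_min => /andP[rd1 rd2] srt; have rge0 := ltW r0.
have q0 : 0 <= t - (s + r) by rewrite subr_ge0.
(* With a = T_s u and b = T_q v, the two values to compare become <T_r a, b> and <a, T_r b>, so both
   factors are expanded forward in time. *)
rewrite /F; have -> : t - s = r + (t - (s + r)) by ring.
move: (t - (s + r)) q0 => q q0.
have {H1} := H1 s r s0 r0 rd1; have {H2} := H2 q r q0 r0 rd2.
have La := TL _ _ s0 Lu; have Lb := TL _ _ q0 Lv.
have LTa := TL _ _ rge0 La; have LTb := TL _ _ rge0 Lb.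
have Lga := TL _ _ s0 Lh; have Lgb := TL _ _ q0 Lk.
have uhs := generator_T s0 uh; have vkq := generator_T q0 vk.
have Eab : pairing m (T s h) (T q v) = pairing m (T s u) (T q k).
  move: uhs vkq => [Da [_ Ea]] [Db [_ Eb]].
  by rewrite -Ea// (E_sym DF)// Eb// pairingC.
have na := T_contract TS p12 s0 Lu; have nb := T_contract TS p12 q0 Lv.
rewrite (addrC s r).
rewrite (pairing_ael (TL _ _ (addr_ge0 rge0 s0) Lu) LTa Lb (T_semigroup TS p12 rge0 s0 Lu)).
rewrite (pairingC m _ (T (r + q) v)).
rewrite (pairing_ael (TL _ _ (addr_ge0 rge0 q0) Lv) LTb La (T_semigroup TS p12 rge0 q0 Lv)).
move: (T s u) (T q v) (T r (T s u)) (T r (T q v)) (T s h) (T q k) La Lb LTa LTb Lga Lgb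
  Eab na nb {uhs vkq} => a b Ta Tb ga gb La Lb LTa LTb Lga Lgb Eab na nb.
have Lgar := inLpZ r p12 Lga; have Lgbr := inLpZ r p12 Lgb.
have Lra := inLpB p12 (inLpB p12 La LTa) Lgar.
have Lrb := inLpB p12 (inLpB p12 Lb LTb) Lgbr.
move=> nrb nra.
have h1 := pairing_CS Lra Lb; have h2 := pairing_CS Lrb La.
have h1' : `|pairing m (fun x => a x - Ta x - r * ga x) b| <=
    eps / (nrm m 2 u + nrm m 2 v + 1) * r * nrm m 2 v.
  by apply: le_trans h1 _; rewrite ler_pM// ?nrm_ge0.
have h2' : `|pairing m (fun x => b x - Tb x - r * gb x) a| <=
    eps / (nrm m 2 u + nrm m 2 v + 1) * r * nrm m 2 u.
  by apply: le_trans h2 _; rewrite ler_pM// ?nrm_ge0.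
move: h1' h2'; have Laa := inLpB p12 La LTa; have Lbb := inLpB p12 Lb LTb.
rewrite !pairingBl// !pairingZl// Eab (pairingC m b a) (pairingC m gb a).
rewrite !ler_norml => /andP[h3 _] /andP[_ h4].
have h5 : eps / (nrm m 2 u + nrm m 2 v + 1) * r * (nrm m 2 u + nrm m 2 v) <= eps * r.
  rewrite [leLHS]mulrAC ler_wpM2r// mulrAC ler_pdivrMr// ler_wpM2l ?(ltW eps0)//.
  by rewrite lerDl.
rewrite mulrDr in h5.
rewrite -lerBlDl (le_trans _ h5)//.
move: (pairing m Ta b) (pairing m Tb a) (pairing m a b) (pairing m a gb)
   (_ * nrm m 2 u) (_ * nrm m 2 v) h3 h4 {h5} => x1 x2 x3 x4 x5 x6 h3 h4.
lra.
Qed.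

Lemma generator_symmetric u h v k t : 0 <= t ->
  assoc_op m D E u h -> assoc_op m D E v k ->
  pairing m (T t u) v = pairing m u (T t v).
Proof.
move=> t0 uh vk; apply/eqP; rewrite eq_le (generator_symmetric_le t0 uh vk).
by rewrite pairingC [leRHS]pairingC (generator_symmetric_le t0 vk uh).
Qed.

Lemma generator_dense f : inLp m 2 f -> forall eps, 0 < eps ->
  exists u h, assoc_op m D E u h /\ nrm m 2 (fun x => u x - f x) <= eps.
Proof.
move=> Lf eps eps0; have e20 : 0 < eps / 2 by rewrite divr_gt0.
have [g Dg fg] := D_dense DF Lf e20; have Lg := D_inLp DF Dg.
have [u [h [uh ug _]]] := resolvent_approx DF Dg e20.
have Lu : inLp m 2 u by case: uh => /(D_inLp DF).
exists u, h; split=> //; apply: le_trans (nrm_dist p12 Lu Lg Lf) _.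
by rewrite [leRHS]splitr lerD// nrmBC.
Qed.

Lemma T_symmetric f g t : 0 <= t -> inLp m 2 f -> inLp m 2 g ->
  pairing m (T t f) g = pairing m f (T t g).
Proof.
move=> t0 Lf Lg; have TL := T_inLp TS p12.
have [nf0 ng0] := conj (nrm_ge0 m 2 f) (nrm_ge0 m 2 g).
pose K := nrm m 2 f + nrm m 2 g + 1.
have K0 : 0 < K by rewrite ltr_wpDl// addr_ge0.
apply/eqP; rewrite -subr_eq0 -normr_le0; apply/ler_addgt0Pr => eps eps0; rewrite add0r.
pose e := Num.min 1 (eps / (2 * K)).
have e0 : 0 < e by rewrite lt_min ltr01 divr_gt0// mulr_gt0.
have e1 : e <= 1 by rewrite ge_min lexx.
have eK : e * (2 * K) <= eps by rewrite -ler_pdivlMr ?mulr_gt0// ge_min lexx orbT.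
have [u [h [uh fu]]] := generator_dense Lf e0.
have [v [k [vk gv]]] := generator_dense Lg e0.
have Lu : inLp m 2 u by case: uh => /(D_inLp DF).
have Lv : inLp m 2 v by case: vk => /(D_inLp DF).
have nv : nrm m 2 v <= nrm m 2 g + e.
  by apply: le_trans (nrm_le_dist p12 Lv Lg) _; rewrite lerD2l.
have fuL := inLpB p12 Lf Lu; have gvL := inLpB p12 Lg Lv.
have LTf := TL _ _ t0 Lf; have LTu := TL _ _ t0 Lu.
have LTg := TL _ _ t0 Lg; have LTv := TL _ _ t0 Lv.
(* Each of the four differences is estimated by Cauchy-Schwarz, with [|v| <= |g| + e]. The sum is at
   most 2 e (|f| + |g| + e), hence at most 2 K e since [e <= 1]. *)
have -> : pairing m (T t f) g - pairing m f (T t g) =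
    pairing m (T t f) (fun x => g x - v x) +
    pairing m (fun x => T t f x - T t u x) v -
    pairing m f (fun x => T t g x - T t v x) -
    pairing m (fun x => f x - u x) (T t v).
  rewrite !pairingBr// !pairingBl// (generator_symmetric t0 uh vk); ring.
have b1 : `|pairing m (T t f) (fun x => g x - v x)| <= nrm m 2 f * e.
  apply: le_trans (pairing_CS LTf gvL) _.
  rewrite ler_pM ?nrm_ge0//; [exact: (T_contract TS p12)|by rewrite nrmBC].
have b2 : `|pairing m (fun x => T t f x - T t u x) v| <= e * (nrm m 2 g + e).
  apply: le_trans (pairing_CS (inLpB p12 LTf LTu) Lv) _.
  rewrite ler_pM ?nrm_ge0//; apply: le_trans (T_dist TS p12 t0 Lf Lu) _.
  by rewrite nrmBC.
have b3 : `|pairing m f (fun x => T t g x - T t v x)| <= nrm m 2 f * e.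
  apply: le_trans (pairing_CS Lf (inLpB p12 LTg LTv)) _.
  rewrite ler_pM ?nrm_ge0//; apply: le_trans (T_dist TS p12 t0 Lg Lv) _.
  by rewrite nrmBC.
have b4 : `|pairing m (fun x => f x - u x) (T t v)| <= e * (nrm m 2 g + e).
  apply: le_trans (pairing_CS fuL LTv) _.
  rewrite ler_pM ?nrm_ge0//; first by rewrite nrmBC.
  exact: le_trans (T_contract TS p12 t0 Lv) nv.
apply: le_trans eK; rewrite /K.
apply: le_trans (ler_normB _ _) _; apply: le_trans (lerD (ler_normB _ _) (lexx _)) _.
apply: le_trans (lerD (lerD (ler_normD _ _) (lexx _)) (lexx _)) _.
move: (e) e0 e1 b1 b2 b3 b4 {fu gv nv} => {}e e0 e1 b1 b2 b3 b4.
have : e * e <= e by rewrite -[leRHS]mulr1 ler_wpM2l// ltW.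
move: `|_| `|_| `|_| `|_| b1 b2 b3 b4 => B1 B2 B3 B4 b1 b2 b3 b4.
by move: (nrm _ _ _) (nrm _ _ _) b1 b2 b3 b4 => *; lra.
Qed.

(** Cutting an approximant [g] at c brings it no farther from f, because f <= c. The resolvent then
    smooths the cut function into the generator domain without exceeding c. *)
Lemma submarkov_L2 c f t : 0 <= c -> 0 <= t -> inLp m 2 f ->
  (forall x, f x <= c) -> {ae m, forall x, T t f x <= c}.
Proof.
move=> c0 t0 Lf fc; have TL := T_inLp TS p12.
apply: (le_closed p12 c0 (TL _ _ t0 Lf)) => eps eps0.
have e20 : 0 < eps / 2 by rewrite divr_gt0.
have [g Dg fg] := D_dense DF Lf e20; have Lg := D_inLp DF Dg.
have Dc := D_cut DF c0 Dg; have Lc := D_inLp DF Dc.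
have [u [h [uh uc ule]]] := resolvent_approx DF Dc e20.
have Lu : inLp m 2 u by case: uh => /(D_inLp DF).
exists (T t u); split; first exact: TL.
  apply: (submarkov_generator c0 t0 uh); apply: ule => // x.
  by rewrite ge_min lexx orbT.
apply: le_trans (T_dist TS p12 t0 Lf Lu) _.
apply: le_trans (nrm_dist p12 Lf Lc Lu) _.
rewrite [leRHS]splitr lerD//; last by rewrite nrmBC.
apply: le_trans fg; have [] // := inLp_le p12 (inLp_meas (inLpB p12 Lf Lc)) (inLpB p12 Lf Lg).
apply: aeW => x; rewrite minEle; case: (leP (g x) c) => // gc.
by have := fc x => fxc; rewrite !ler0_norm; lra.
Qed.

(** The cut at c makes the bound hold at every point, and the truncations of [trunc_dense] take only
    its values or 0, so they lie in L^2 and stay below c. *)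
Lemma submarkov p c f t : 1 <= p -> 0 <= c -> 0 <= t -> inLp m p f ->
  {ae m, forall x, f x <= c} -> {ae m, forall x, T t f x <= c}.
Proof.
move=> p1 c0 t0 Lf fc; have TL := T_inLp TS p1; have Lc := inLp_cut p1 c0 Lf.
have : {ae m, forall x, T t (fun x => Num.min (f x) c) x <= c}.
  apply: (le_closed p1 c0 (TL _ _ t0 Lc)) => eps eps0.
  have [g [Lg L2g fg gE]] := trunc_dense p1 p12 Lc eps0.
  exists (T t g); split; [exact: TL| |exact: le_trans (T_dist TS p1 t0 Lc Lg) fg].
  apply: submarkov_L2 => // x; case: (gE x) => -> //.
  by rewrite ge_min lexx orbT.
have fE : aeeq m f (fun x => Num.min (f x) c).
  by apply: filterS fc => x fxc; rewrite min_l.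
by apply: filterS2 (T_ae TS p1 t0 Lf Lc fE) => x ->.
Qed.

Lemma T_monotone p f g t : 1 <= p -> 0 <= t -> inLp m p f -> inLp m p g ->
  {ae m, forall x, f x <= g x} -> {ae m, forall x, T t f x <= T t g x}.
Proof.
move=> p1 t0 Lf Lg fg.
have : {ae m, forall x, T t (fun x => f x - g x) x <= 0}.
  apply: (submarkov p1) => //; first exact: inLpB.
  by apply: filterS fg => x; rewrite subr_le0.
by apply: filterS2 (T_sub TS p1 t0 Lf Lg) => x ->; rewrite subr_le0.
Qed.

End markov_semigroup.

(** * Fixed functions *)

Section lp_rigidity.
Context {d : measure_display} {X : measurableType d} {R : realType}.
Variable m : {measure set X -> \bar R}.
Implicit Types (f g h u v w : X -> R) (p a b c eps dlt : R).

(** The integrand g^p - f^p is nonnegative and its integral is at most 0, so it vanishes almost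
    everywhere; s -> s^p is injective on nonnegative reals. *)
Lemma nrm_rigid p f g : 1 <= p -> inLp m p f -> inLp m p g ->
  (forall x, 0 <= f x <= g x) -> nrm m p g <= nrm m p f -> aeeq m f g.
Proof.
move=> p1 Lf Lg fg le; have p0 : 0 < p by exact: lt_le_trans p1.
have If := Lfun_integrable p1 (inLp_Lfun p1 Lf).
have Ig := Lfun_integrable p1 (inLp_Lfun p1 Lg).
have fgp x : `|f x| `^ p <= `|g x| `^ p.
  have /andP[f0 fgx] := fg x.
  rewrite ge0_ler_powR ?nnegrE ?(ltW p0)// !ger0_norm//; exact: le_trans fgx.
have h0 : (\int[m]_x `|(`|g x| `^ p - `|f x| `^ p)%:E| = 0)%E.
  under eq_integral do rewrite /= ger0_norm ?subr_ge0// EFinB.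
  rewrite integralB// !nrm_powR// -EFinB; apply/eqP; rewrite eq_le !lee_fin.
  by rewrite subr_le0 subr_ge0 !ge0_ler_powR ?nnegrE ?nrm_ge0 ?(ltW p0)//;
    have [] := inLp_le p1 (inLp_meas Lf) Lg _;
    [apply: aeW => x; have /andP[f0 fgx] := fg x; rewrite !ger0_norm//; exact: le_trans fgx|].
have mgf : measurable_fun setT (fun x => `|g x| `^ p - `|f x| `^ p).
  by apply: measurable_funB; apply: measurable_powR_abs; [case: Lg|case: Lf].
move/measurable_EFinP in mgf.
have /(ae_eq_integral_abs m measurableT mgf) := h0.
apply: filterS => x /(_ I) [/eqP]; rewrite subr_eq0 => /eqP.
have /andP[f0 fgx] := fg x; have g0 := le_trans f0 fgx.
by rewrite !ger0_norm// => /(powR_injective p0) ->//; rewrite nnegrE.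
Qed.

(** When f is positive almost everywhere, the constant is the supremum of the levels c >= 0 that f
    exceeds almost everywhere. *)
Lemma ae_const f :
  (forall c, 0 <= c -> {ae m, forall x, f x <= c} \/ {ae m, forall x, c < f x}) ->
  {ae m, forall x, f x <= 0} \/ exists c, aeeq m f (fun=> c).
Proof.
move=> H; have [|pos] := H 0 (lexx _); first by left.
(* On a space of measure zero every level would be exceeded and the supremum would not exist. *)
have [F|nF] := pselect {ae m, forall x, False}; first by left; apply: filterS F.
pose S : set R := [set c | 0 <= c /\ {ae m, forall x, c < f x}].
have S_le c b : S c -> {ae m, forall x, f x <= b} -> c <= b.
  move=> [_ cf] fb; rewrite leNgt; apply/negP => bc; apply: nF.
  by apply: filterS2 cf fb => x h1 h2; have := lt_le_trans (lt_trans bc h1) h2; rewrite ltxx.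
have S0 : S 0 by [].
have Sub : has_ubound S.
  apply: contrapT => nub; apply: nF.
  have unb n : {ae m, forall x, n%:R < f x}.
    have [fn|//] := H n%:R (ler0n _ _).
    by exfalso; apply: nub; exists n%:R => c Sc; exact: S_le Sc fn.
  apply: filterS (ae_foralln unb) => x /(_ (Num.bound `|f x|)) lt.
  by have := lt_le_trans (lt_trans (archi_boundP (normr_ge0 (f x))) lt) (ler_norm _); rewrite ltxx.
right; exists (sup S).
have up n : {ae m, forall x, f x <= sup S + n.+1%:R^-1}.
  have n0 : 0 < n.+1%:R^-1 :> R by rewrite invr_gt0.
  have sS : 0 <= sup S by apply: ub_le_sup.
  have c0 : 0 <= sup S + n.+1%:R^-1 by rewrite addr_ge0// ltW.
  have [//|lt] := H _ c0.
  have : sup S + n.+1%:R^-1 <= sup S by apply: ub_le_sup.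
  by rewrite gerDl leNgt n0.
have low n : {ae m, forall x, sup S - n.+1%:R^-1 < f x}.
  have n0 : 0 < n.+1%:R^-1 :> R by rewrite invr_gt0.
  have [c [_ cf] lt] := sup_adherent n0 (conj (ex_intro _ 0 S0) Sub).
  by apply: filterS cf => x; exact: lt_trans.
apply: filterS2 (ae_foralln up) (ae_foralln low) => x fup flow.
have small (e : R) : 0 < e -> exists n, n.+1%:R^-1 < e.
  move=> e0; have [N _ HN] := near_infty_natSinv_lt (PosNum e0).
  by exists N; exact: HN (leqnn N).
apply/eqP; rewrite eq_le; apply/andP; split; apply/ler_addgt0Pr => e /small[n ne].
  by apply: le_trans (fup n) _; rewrite lerD2l ltW.
by have := flow n; rewrite ltrBlDr => /ltW /le_trans; apply; rewrite lerD2l ltW.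
Qed.

End lp_rigidity.

(** * Fixed functions of the semigroup and invariance of their positivity sets *)

Section harmonic.
Context {d : measure_display} {X : measurableType d} {R : realType}.
Variable m : {measure set X -> \bar R}.
Variables (D : set (X -> R)) (E : (X -> R) -> (X -> R) -> R).
Variable T : R -> (X -> R) -> (X -> R).
Hypothesis DF : dirichlet_form m D E.
Hypothesis TS : assoc_semigroup m D E T.
Implicit Types (f g h k u v w : X -> R) (p a b c s t r eps dlt : R).

Let p12 : (1 : R) <= 2. Proof. by rewrite ler1n. Qed.

Lemma harmonic_fixed p f t : 1 <= p -> Lp_harmonic m p T f -> 0 <= t ->
  aeeq m (T t f) f.
Proof.
move=> p1 /(gen_relP TS _ _ p1)[Lf _ H] t0; have TL := T_inLp TS p1.
apply: (nrm_dist_eq0 p1 (TL _ _ t0 Lf) Lf).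
pose F s := nrm m p (fun x => T s f x - f x).
have -> : 0 = F 0.
  by rewrite /F nrm_dist_ae//; [exact: TL|exact: (T0_id TS p1 Lf)].
change (F t <= F 0); apply: uniform_dini_le => // eps /H[dlt dlt0 {}H].
exists dlt => // s r s0 r0 rdlt _; have := H r r0 rdlt.
rewrite (_ : (fun x => f x - T r f x - r * cst 0 x) = fun x => f x - T r f x); last first.
  by apply/funext => x; rewrite mulr0 subr0.
move=> le; have rge0 := ltW r0; rewrite [leRHS]addrC /F.
have Lr := TL _ _ rge0 Lf; have Ls := TL _ _ s0 Lf; have Lsr := TL _ _ s0 Lr.
have Lrs := TL _ _ (addr_ge0 s0 rge0) Lf.
apply: le_trans (nrm_dist p1 Lrs Ls Lf) _; rewrite lerD2r.
apply: le_trans le; apply: le_trans (nrm_dist p1 Lrs Lsr Ls) _.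
rewrite (nrm_dist_ae p1 Lrs Lsr (T_semigroup TS p1 s0 rge0 Lf)) add0r.
by rewrite (nrmBC p1 Lf Lr); exact: (T_dist TS p1 s0 Lr Lf).
Qed.

(** Contraction leaves no room for growth: [G] represents [T t g], lies above g at every point, and
    has norm at most that of g. *)
Lemma subinvariant_fixed p g t : 1 <= p -> 0 <= t -> inLp m p g ->
  (forall x, 0 <= g x) -> {ae m, forall x, g x <= T t g x} -> aeeq m (T t g) g.
Proof.
move=> p1 t0 Lg g0 gT; have LT := T_inLp TS p1 t0 Lg.
pose G x := Num.max (T t g x) (g x).
have GT : aeeq m G (T t g) by apply: filterS gT => x gx; rewrite /G max_l.
have mG : measurable_fun setT G.
  by apply: measurable_maxr; [case: LT|case: Lg].
have [LG nG] := nrm_ae p1 mG LT GT.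
apply: aeeq_trans (aeeq_sym GT) _; apply: aeeq_sym.
apply: (nrm_rigid p1 Lg LG) => [x|]; first by rewrite g0 /G le_max lexx orbT.
by rewrite nG; exact: (T_contract TS p1 t0 Lg).
Qed.

(** By monotonicity and the sub-Markov bound, [T t] maps the cut of f below both f and c, hence
    below the cut itself; subtracting from f shows that the excess is subinvariant. *)
Lemma excess_fixed p f c t : 1 <= p -> 0 <= c -> 0 <= t -> inLp m p f ->
  aeeq m (T t f) f ->
  aeeq m (T t (fun x => f x - Num.min (f x) c)) (fun x => f x - Num.min (f x) c).
Proof.
move=> p1 c0 t0 Lf Tf; have Lc := inLp_cut p1 c0 Lf; have Lw := inLpB p1 Lf Lc.
apply: (subinvariant_fixed p1 t0 Lw) => [x|]; first by rewrite subr_ge0 ge_min lexx.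
have le1 : {ae m, forall x, T t (fun x => Num.min (f x) c) x <= T t f x}.
  by apply: (T_monotone DF TS p1 t0 Lc Lf); apply: aeW => x; rewrite ge_min lexx.
have le2 : {ae m, forall x, T t (fun x => Num.min (f x) c) x <= c}.
  apply: (submarkov DF TS p1 c0 t0 Lc).
  by apply: aeW => x; rewrite ge_min lexx orbT.
apply: filterS3 (T_sub TS p1 t0 Lf Lc) Tf (filterI le1 le2) => x -> Tfx [h1 h2].
by rewrite Tfx lerD2l lerN2 le_min h2 andbT -Tfx.
Qed.

(* If k vanishes off {h > 0}, the truncations of k at the levels -n h and n h
   converge to k, and T_t maps them into [-n h, n h]. *)
Lemma T_vanish p h k t : 1 <= p -> 0 <= t -> inLp m p h -> (forall x, 0 <= h x) ->
  aeeq m (T t h) h -> inLp m 2 k -> (forall x, h x = 0 -> k x = 0) ->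
  {ae m, forall x, h x = 0 -> T t k x = 0}.
Proof.
move=> p1 t0 Lh h0 Th Lk kh; have TL2 := T_inLp TS p12 t0.
pose u (n : nat) x := Num.max (- (n%:R * h x)) (Num.min (n%:R * h x) (k x)).
have mu n : measurable_fun setT (u n).
  have mnh : measurable_fun setT (fun x => n%:R * h x).
    by apply: measurable_funM => //; exact: inLp_meas Lh.
  apply: measurable_maxr; first exact: measurableT_comp.
  by apply: measurable_minr => //; exact: inLp_meas Lk.
have nh0 n x : 0 <= n%:R * h x by rewrite mulr_ge0.
have u_bound n x : - (n%:R * h x) <= u n x <= n%:R * h x.
  by rewrite /u le_max lexx/= ge_max ge_min lexx/= andbT; have := nh0 n x; lra.
have u_near n x : `|k x - u n x| <= `|k x|.
  rewrite /u; have := nh0 n x; move: (n%:R * h x) (k x) => y z y0; rewrite maxEle minEle.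
  case: (leP y z) => yz; [case: (leP (- y) y)|case: (leP (- y) z)] => yz2.
  - by rewrite !ger0_norm; lra.
  - by lra.
  - by rewrite subrr normr0.
  - by rewrite !ler0_norm; lra.
have u_cvg x : \forall n \near \oo, u n x = k x.
  have [hx|hx] := eqVneq (h x) 0.
    by apply: nearW => n; rewrite /u hx mulr0 oppr0 (kh _ hx) minxx maxxx.
  have hp : 0 < h x by rewrite lt_neqAle eq_sym hx h0.
  near=> n; have : `|k x| <= n%:R * h x.
    by rewrite -ler_pdivrMr//; near: n; exact: nbhs_infty_ger.
  by rewrite ler_norml /u => /andP[l1 l2]; rewrite min_r// max_r.
(* The truncations link the two spaces: domination by n h puts them in L^p, where they can be
   compared with h, while their convergence to k takes place in L^2. *)
have Lu n : inLp m p (u n).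
  apply: (inLp_dom p1 (mu n) (inLpZ n%:R p1 Lh)) => x.
  by rewrite [leRHS]ger0_norm// ler_norml.
have Tu n : {ae m, forall x, h x = 0 -> T t (u n) x = 0}.
  have Lnh := inLpZ n%:R p1 Lh; have LNnh := inLpN p1 Lnh.
  have le1 : {ae m, forall x, T t (u n) x <= T t (fun x => n%:R * h x) x}.
    by apply: (T_monotone DF TS p1 t0 (Lu n) Lnh); apply: aeW => x; case/andP: (u_bound n x).
  have le2 : {ae m, forall x, T t (fun x => - (n%:R * h x)) x <= T t (u n) x}.
    by apply: (T_monotone DF TS p1 t0 LNnh (Lu n)); apply: aeW => x; case/andP: (u_bound n x).
  have e1 := T_scale TS n%:R p1 t0 Lh; have e2 := T_opp TS p1 t0 Lnh.
  apply: filterS3 (filterI le1 le2) (filterI e1 e2) Th => x [l1 l2] [e3 e4] e5 hx.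
  move: l1 l2; rewrite e4 e3 e5 hx mulr0 oppr0 => l1 l2.
  by apply/eqP; rewrite eq_le l1.
(* [z] is [T t k] restricted to the zero set of h. There [T t (u n)] vanishes, so |z| is at most |T
   t k - T t (u n)|, which is small in L^2. *)
pose z x := T t k x * \1_[set x | h x = 0] x.
have zE x : h x = 0 /\ z x = T t k x \/ h x <> 0 /\ z x = 0.
  rewrite /z indicE; have [hx|hx] := pselect (h x = 0).
    by left; rewrite mem_set// mulr1.
  by right; rewrite memNset// mulr0.
have LTk := TL2 _ Lk.
have mz : measurable_fun setT z.
  apply: measurable_funM; first exact: inLp_meas LTk.
  apply: measurable_indic; rewrite (_ : [set x | _] = h @^-1` [set 0])//.
  by rewrite -[X in measurable X]setTI; apply: (inLp_meas Lh).
have Lz : inLp m 2 z.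
  by apply: (inLp_dom p12 mz LTk) => x; case: (zE x) => -[_ ->]//; rewrite normr0.
have : aeeq m z (fun=> 0).
  apply: (aeeq_nrm_small p12 Lz (inLp0 m p12)) => eps eps0.
  have [n [L2u ku]] := nrm_dominated p12 Lk mu u_near u_cvg eps0.
  have LTu := TL2 _ L2u.
  apply: le_trans (le_trans (T_dist TS p12 t0 Lk L2u) ku).
  have [] // := inLp_le p12 (inLp_meas (inLpB p12 Lz (inLp0 m p12))) (inLpB p12 LTk LTu).
  apply: filterS (Tu n) => x Tux; rewrite subr0.
  by case: (zE x) => -[hx ->]; rewrite ?normr0// Tux// subr0.
apply: filterS => x; case: (zE x) => -[hx ->]// _ /hx.
Unshelve. all: end_near. Qed.

Lemma invariant_positivity p h : 1 <= p -> inLp m p h -> (forall x, 0 <= h x) ->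
  (forall t, 0 <= t -> aeeq m (T t h) h) -> invariant_set m T [set x | 0 < h x].
Proof.
move=> p1 Lh h0 Th t g t0 Lg; set A := [set x | _].
have TL := T_inLp TS p12 t0.
have mA : measurable A.
  rewrite (_ : A = h @^-1` `]0, +oo[); last by apply/seteqP; split=> x; rewrite /= in_itv/= andbT.
  by rewrite -[X in measurable X]setTI; apply: (inLp_meas Lh).
have AE x : h x = 0 /\ \1_A x = 0 :> R \/ h x <> 0 /\ \1_A x = 1 :> R.
  rewrite indicE; have [hx|hx] := pselect (h x = 0).
    by left; rewrite memNset// /A /= hx ltxx.
  by right; rewrite mem_set// /A /= lt_neqAle h0 andbT eq_sym; apply/eqP.
have L1 k : inLp m 2 k -> inLp m 2 (fun x => \1_A x * k x).
  move=> Lk; apply: (inLp_dom p12 _ Lk).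
    by apply: measurable_funM; [exact: measurable_indic|exact: inLp_meas Lk].
  by move=> x; case: (AE x) => -[_ ->]; rewrite ?mul0r ?normr0 ?mul1r.
have off k : inLp m 2 k -> {ae m, forall x, h x = 0 -> T t (fun x => \1_A x * k x) x = 0}.
  move=> Lk; apply: (T_vanish p1 t0 Lh h0 (Th t t0) (L1 _ Lk)) => x hx.
  by case: (AE x) => -[h1 ->]; rewrite ?mul0r.
(* [b] is the part of g off A. With z = 1_A T_t b, symmetry gives |z|^2 = <T_t b, z> = <b, T_t z>,
   and this is 0 because [T t z] lives on A. So neither A nor its complement leaks into the
   other. *)
have Lgb := inLpB p12 Lg (L1 _ Lg); set b := (fun x => g x - \1_A x * g x) in Lgb.
have LTb := TL _ Lgb; have Lz := L1 _ LTb; have LTz := TL _ Lz.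
have : aeeq m (fun x => \1_A x * T t b x) (fun=> 0).
  apply: (nrm_eq0 p12 Lz); apply/eqP; rewrite -sqrf_eq0 -pairing_sqr//.
  have -> : pairing m (fun x => \1_A x * T t b x) (fun x => \1_A x * T t b x) =
      pairing m (T t b) (fun x => \1_A x * T t b x).
    rewrite /pairing; congr fine; apply: eq_integral => x _; congr EFin.
    by case: (AE x) => -[_ ->]; ring.
  rewrite (T_symmetric DF TS t0 Lgb Lz) pairingC.
  rewrite (pairing_ael LTz (L1 _ LTz) Lgb); last first.
    apply: filterS (off _ LTb) => x; case: (AE x) => -[hx ->]; last by rewrite mul1r.
    by move=> /(_ hx) ->; rewrite mul0r.
  rewrite /pairing (_ : (fun x => _) = cst 0%E) ?integral0//.
  apply/funext => x; congr EFin; rewrite /b.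
  by case: (AE x) => -[_ ->]; ring.
have e1 := T_sub TS p12 t0 Lg (L1 _ Lg); rewrite -/b in e1.
apply: filterS3 e1 (off _ Lg) => x; rewrite /b.
case: (AE x) => -[hx ->] e2 Toff; rewrite ?mul0r ?mul1r => e3; first exact: Toff.
by apply/eqP; rewrite eq_sym -subr_eq0 -e2 e3.
Qed.

(** Levels are available only for c >= 0, so the dichotomy is applied to f and to -f; if neither
    yields a constant, both are nonpositive and f = 0. *)
Lemma fixed_constant p f : 1 <= p -> irreducible m T -> inLp m p f ->
  (forall t, 0 <= t -> aeeq m (T t f) f) -> exists c, aeeq m f (fun=> c).
Proof.
move=> p1 irr.
have level g c : inLp m p g -> (forall t, 0 <= t -> aeeq m (T t g) g) -> 0 <= c ->
    {ae m, forall x, g x <= c} \/ {ae m, forall x, c < g x}.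
  move=> Lg Tg c0; have Lw := inLpB p1 Lg (inLp_cut p1 c0 Lg).
  pose w x := g x - Num.min (g x) c; rewrite -/w in Lw.
  have w0 x : 0 <= w x by rewrite subr_ge0 ge_min lexx.
  have mA : measurable [set x | 0 < w x].
    rewrite (_ : [set x | _] = w @^-1` `]0, +oo[); last first.
      by apply/seteqP; split=> x; rewrite /= in_itv/= andbT.
    by rewrite -[X in measurable X]setTI; apply: (inLp_meas Lw).
  have inv := invariant_positivity p1 Lw w0 (fun t tge => excess_fixed p1 c0 tge Lg (Tg _ tge)).
  have wE x : (0 < w x) = (c < g x).
    by rewrite /w minEle; case: (leP (g x) c) => gc; rewrite ?subrr ?ltxx// subr_gt0 gc.
  have [m0|m0] := irr _ mA inv; [left|right].
    exists [set x | 0 < w x]; split=> // x /= /negP; rewrite -ltNge.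
    by rewrite wE.
  exists (~` [set x | 0 < w x]); split=> //; first exact: measurableC.
  by move=> x /=; rewrite wE.
move=> Lf Tf; have LNf := inLpN p1 Lf.
have TNf t : 0 <= t -> aeeq m (T t (fun x => - f x)) (fun x => - f x).
  by move=> t0; apply: filterS2 (T_opp TS p1 t0 Lf) (Tf t t0) => x -> ->.
have [f_le|//] := ae_const (fun c => @level _ c Lf Tf).
have [f_ge|[c fc]] := ae_const (fun c => @level _ c LNf TNf); last first.
  by exists (- c); apply: filterS fc => x <-; rewrite opprK.
exists 0; apply: filterS2 f_le f_ge => x l1; rewrite oppr_le0 => l2.
by apply/eqP; rewrite eq_le l1.
Qed.

End harmonic.

(** * Constants, total mass and conservativeness *)

Section constants.
Context {d : measure_display} {X : measurableType d} {R : realType}.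
Variable m : {measure set X -> \bar R}.
Variables (D : set (X -> R)) (E : (X -> R) -> (X -> R) -> R).
Variable T : R -> (X -> R) -> (X -> R).
Hypothesis DF : dirichlet_form m D E.
Hypothesis TS : assoc_semigroup m D E T.
Implicit Types (f g h : X -> R) (p a c t eps : R).

Let p12 : (1 : R) <= 2. Proof. by rewrite ler1n. Qed.

Lemma inLp_cst_finite p c : 1 <= p -> c != 0 -> inLp m p (fun=> c) ->
  (m setT < +oo)%E.
Proof.
move=> p1 c0 Lc; have := nrm_powR p1 Lc.
rewrite (integral_cst m measurableT (`|c| `^ p)%:E) => h.
have cp : 0 < `|c| `^ p by rewrite powR_gt0// normr_gt0.
rewrite ltNge leye_eq; apply/negP => /eqP mX.
by move: h; rewrite mX gt0_muley// lte_fin.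
Qed.

Lemma finite_inLp_cst p c : 1 <= p -> (m setT < +oo)%E -> inLp m p (fun=> c).
Proof.
move=> p1 mX; split=> //; rewrite unlock poweR_lty//.
rewrite (integral_cst m measurableT (`|c| `^ p)%:E).
by rewrite lte_mul_pinfty// lee_fin powR_ge0.
Qed.

Lemma pairing1_dist g h : inLp m 1 g -> inLp m 1 h ->
  `|pairing m (cst 1) g - pairing m (cst 1) h| <= nrm m 1 (fun x => g x - h x).
Proof.
move=> Lg Lh; have Lgh := inLpB (lexx 1) Lg Lh.
have I f : inLp m 1 f -> m.-integrable setT (EFin \o f).
  by move=> Lf; apply/Lfun1_integrable; exact: inLp_Lfun.
have P f : inLp m 1 f -> (\int[m]_x (f x)%:E = (pairing m (cst 1) f)%:E)%E.
  move=> Lf; rewrite /pairing; under [in RHS]eq_integral do rewrite /= mul1r.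
  by rewrite fineK//; exact: integrable_fin_num (I _ Lf).
rewrite -lee_fin -abse_EFin EFinB -!P// -integralB//; [|exact: I..].
rewrite -nrmE// Lnorm1; apply: le_abse_integral => //.
by have /integrableP[] := I _ Lgh.
Qed.

(** Conservativeness is tested against L^1 but symmetry is known on L^2. Finite mass puts 1 in L^2,
    so <1, T_t h> = <T_t 1, h> = <1, h> for h in both spaces, and contraction on L^1 passes to the
    limit. *)
Lemma conservative_of_fixed1 : (m setT < +oo)%E ->
  (forall t, 0 <= t -> aeeq m (T t (cst 1)) (cst 1)) -> conservative m T.
Proof.
move=> mX T1 t t_ge0 g Lg; have TL1 := T_inLp TS (lexx 1) t_ge0.
have L1 := finite_inLp_cst 1 p12 mX.
apply/eqP; rewrite -subr_eq0 -normr_le0; apply/ler_addgt0Pr => eps eps0; rewrite add0r.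
have e20 : 0 < eps / 2 by rewrite divr_gt0.
have [h [Lh L2h gh _]] := trunc_dense (lexx 1) p12 Lg e20.
have eqh : pairing m (cst 1) (T t h) = pairing m (cst 1) h.
  rewrite -(T_symmetric DF TS t_ge0 L1 L2h).
  by apply: (pairing_ael (T_inLp TS p12 t_ge0 L1) L1 L2h); exact: T1.
have -> : pairing m (cst 1) g - pairing m (cst 1) (T t g) =
    (pairing m (cst 1) g - pairing m (cst 1) h) +
    (pairing m (cst 1) (T t h) - pairing m (cst 1) (T t g)) by rewrite eqh; ring.
apply: le_trans (ler_normD _ _) _; rewrite [leRHS]splitr lerD//.
  exact: le_trans (pairing1_dist Lg Lh) gh.
apply: le_trans (pairing1_dist (TL1 _ Lh) (TL1 _ Lg)) _.
apply: le_trans (T_dist TS (lexx 1) t_ge0 Lh Lg) _.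
by rewrite nrmBC.
Qed.

Lemma aeeq_cst_mean f c : (m setT < +oo)%E -> measurable_fun setT f ->
  aeeq m f (cst c) -> aeeq m f (cst (fine (\int[m]_x (f x)%:E) / fine (m setT))).
Proof.
move=> mX mf fc; have mXfin : m setT \is a fin_num by rewrite ge0_fin_numE.
(* If the total mass is 0, the mean is a division by zero, but any two functions agree almost
   everywhere. *)
have [mX0|mX0] := eqVneq (m setT) 0%E; first exact: measure0_ae.
rewrite (ae_eq_integral (cst c%:E)) ?integral_cst//; first last.
- by apply: filterS fc => x -> _.
- exact/measurable_EFinP.
rewrite fineM// mulfK//; apply: contra mX0 => /eqP mX0.
by rewrite -(fineK mXfin) mX0.
Qed.

End constants.

Theorem theorem1 (d : measure_display) (X : measurableType d) (R : realType)
  (m : {measure set X -> \bar R})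
  (D : set (X -> R)) (E : (X -> R) -> (X -> R) -> R)
  (T : R -> (X -> R) -> (X -> R))
  (p : R) (f : X -> R) :
  sigma_finite setT m ->
  dirichlet_form m D E ->
  assoc_semigroup m D E T ->
  irreducible m T ->
  1 < p ->
  Lp_harmonic m p T f ->
  aeeq m f (cst (if (m setT < +oo)%E && `[< conservative m T >]
                 then fine (\int[m]_x (f x)%:E) / fine (m setT)
                 else 0)) /\
  (~ aeeq m f (cst 0) -> (m setT < +oo)%E).
Proof.
move=> _ DF TS irr p1 fh; have pge1 := ltW p1.
have Lf : inLp m p f by case: fh.
have [c fc] := fixed_constant DF TS pge1 irr Lf (fun t => harmonic_fixed TS pge1 fh).
have [c0|c_neq0] := eqVneq c 0.
  (* For c = 0 the first branch asks for the mean of f, which represents the same constant, and the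
     claim about nonzero f is vacuous. *)
  subst c; split=> [|/(_ fc)//]; case: ifPn => // /andP[mX _].
  exact: aeeq_cst_mean mX (inLp_meas Lf) fc.
have [Lc _] : inLp m p (cst c) /\ nrm m p (cst c) = nrm m p f.
  by apply: nrm_ae => //; exact: aeeq_sym.
have mX := inLp_cst_finite pge1 c_neq0 Lc.
(* A nonzero constant excludes the second branch: c T_t 1 = T_t f = f = c almost everywhere, and c
   cancels. *)
split=> //; rewrite mX /=; have -> : `[< conservative m T >].
  apply/asboolP; apply: (conservative_of_fixed1 DF TS mX) => t t0.
  have L1 := finite_inLp_cst 1 pge1 mX.
  have Tf := harmonic_fixed TS pge1 fh t0.
  have Tfc := T_ae TS pge1 t0 Lf Lc fc.
  have := T_scale TS c pge1 t0 L1.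
  rewrite (_ : (fun x : X => c * 1) = cst c); last by apply/funext => x; rewrite mulr1.
  move=> Tc; apply: filterS3 (filterI Tc Tfc) Tf fc => x [e1 e2] e3 e4.
  by apply: (mulfI c_neq0); rewrite -e1 -e2 e3 e4 /= mulr1.
exact: aeeq_cst_mean mX (inLp_meas Lf) fc.
Qed.
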